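(* Let $n\ge 3$. Irreducible representations of the $n$-Lie algebra $W^n$ are in one-to-one correspondence with irreducible representations of the universal enveloping algebra $U(W_{n-1})$ on which the two-sided ideal $Q(W^n)$, generated by the elements $$x_{a_1,\dots,a_{2n-2}}=\mathrm{ad}([a_1,\dots,a_n]\wedge a_{n+1}\wedge\cdots\wedge a_{2n-2})-\sum_{i=1}^n(-1)^{i+n}\,\mathrm{ad}(a_1\wedge\cdots\wedge\widehat{a_i}\wedge\cdots\wedge a_n)\,\mathrm{ad}(a_i\wedge a_{n+1}\wedge\cdots\wedge a_{2n-2})$$ for $a_1,\dots,a_{2n-2}\in W^n$, acts trivially.
   Context: $\mathbb{F}$ is a field of characteristic zero. An $n$-Lie algebra is a vector space $V$ with an $n$-linear alternating bracket satisfying $[a_1,\dots,a_{n-1},[b_1,\dots,b_n]]=\sum_{i=1}^n[b_1,\dots,[a_1,\dots,a_{n-1},b_i],\dots,b_n]$. Put $\mathrm{ad}(a_1\wedge\cdots\wedge a_{n-1})(b)=[a_1,\dots,a_{n-1},b]$ (extended linearly to $\wedge^{n-1}V$), and let $\mathrm{Inder}(V)$ be the image of $\mathrm{ad}$, the Lie algebra (under commutator) of inner derivations. A representation (an $n$-Lie module) of $V$ is a vector space $M$ with an $n$-Lie algebra structure on $V\oplus M$ such that $V$ is a subalgebra and $M$ is an abelian ideal (brackets with at least one entry in $M$ lie in $M$; with at least two entries in $M$ vanish). $W^n=\mathbb{F}[[x_1,\dots,x_{n-1}]]$ with $[f_1,\dots,f_n]$ equal to the determinant of the $n\times n$ matrix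 with first row $(f_1,\dots,f_n)$ and $(i+1)$-st row $(D_i(f_1),\dots,D_i(f_n))$, $i=1,\dots,n-1$, where $D_i=\partial/\partial x_i$. $W_{n-1}$ is the Lie algebra of continuous derivations $\sum_{i=1}^{n-1}f_iD_i$, $f_i\in\mathbb{F}[[x_1,\dots,x_{n-1}]]$, of $\mathbb{F}[[x_1,\dots,x_{n-1}]]$. The Lie algebras $\mathrm{Inder}(W^n)$ and $W_{n-1}$ are identified via $\mathrm{ad}(f_1\wedge\cdots\wedge f_{n-1})\mapsto\sum_{i=1}^{n-1}(-1)^{n+1-i}\Delta_iD_i$, where $\Delta_i$ is the determinant of the matrix with rows $(f_1,\dots,f_{n-1})$ and $(D_j(f_1),\dots,D_j(f_{n-1}))$, $j\neq i$, in increasing order of $j$. Via this identification the elements $x_{a_1,\dots,a_{2n-2}}$ are elements of $U(W_{n-1})$, the product of two $\mathrm{ad}$'s being taken in $U(W_{n-1})$. A hat denotes omission; ''acts trivially'' means acts by zero. *)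

(* Defs.v *)
From HB Require Import structures.
From mathcomp Require Import all_boot all_order all_algebra.
From mathcomp Require Import boolp.
From mathcomp Require Import monalg mpoly.


Set Implicit Arguments.
Unset Strict Implicit.
Unset Printing Implicit Defensive.

Import GRing.Theory.
Local Open Scope ring_scope.

(* Argument lists: fcons x u = (x, u_0, ..), frcons u x = (u_0, .., x). *)
Definition fcons (T : Type) (p : nat) (x : T) (u : 'I_p -> T) : 'I_p.+1 -> T :=
  fun j => if unlift ord0 j is Some j' then u j' else x.

Definition frcons (T : Type) (p : nat) (u : 'I_p -> T) (x : T) : 'I_p.+1 -> T :=
  fun j => if unlift ord_max j is Some j' then u j' else x.

Section NLie.
Context (F : fieldType) (k : nat).

Section Structure.
Context (V : lmodType F).
Implicit Type br : ('I_k.+1 -> V) -> V.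

Definition nlinear br : Prop := forall a i (c : F) x y,
  br [eta a with i |-> c *: x + y] =
  c *: br [eta a with i |-> x] + br [eta a with i |-> y].

Definition nalternating br : Prop :=
  forall a i j, i != j -> a i = a j -> br a = 0.

Definition filippov br : Prop := forall (a : 'I_k -> V) (b : 'I_k.+1 -> V),
  br (frcons a (br b)) =
  \sum_(i < k.+1) br [eta b with i |-> br (frcons a (b i))].

(* br makes V an n-Lie algebra, n = k + 1 *)
Definition is_nlie br : Prop := [/\ nlinear br, nalternating br & filippov br].
End Structure.

Section Modules.
Context (V : lmodType F) (brV : ('I_k.+1 -> V) -> V).

(* A representation on M of the n-Lie algebra (V, brV) is a bracket on the
   direct sum V (+) M. *)
Definition nlie_rep (M : lmodType F)
    (B : ('I_k.+1 -> V * M) -> (V * M)%type) : Prop :=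
  [/\ is_nlie B,
      forall a : 'I_k.+1 -> V, B (fun i => (a i, 0)) = (brV a, 0),
      forall z i, (z i).1 = 0 -> (B z).1 = 0
    & forall z i j, i != j -> (z i).1 = 0 -> (z j).1 = 0 -> B z = 0].

(* [a_1, .., a_{n-1}, m], an element of M *)
Definition nlie_act (M : lmodType F) (B : ('I_k.+1 -> V * M) -> (V * M)%type)
    (a : 'I_k -> V) (m : M) : M :=
  (B (frcons (fun i => (a i, 0)) (0, m))).2.
End Modules.
End NLie.

Definition subspace (F : fieldType) (M : lmodType F) (N : M -> Prop) : Prop :=
  N 0 /\ forall (c : F) x y, N x -> N y -> N (c *: x + y).

(* M, acted upon by the operators T i, is nonzero and has no invariant subspace
   other than 0 and M. *)
Definition irreducible_under (F : fieldType) (M : lmodType F) (I : Type)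
    (T : I -> M -> M) : Prop :=
  (exists m : M, m <> 0) /\
  forall N : M -> Prop, subspace N -> (forall i m, N m -> N (T i m)) ->
    (forall m, N m -> m = 0) \/ (forall m, N m).

Definition irr_nlie_rep (F : fieldType) (k : nat) (V : lmodType F)
    (brV : ('I_k.+1 -> V) -> V) (M : lmodType F)
    (B : ('I_k.+1 -> V * M) -> (V * M)%type) : Prop :=
  nlie_rep brV B /\ irreducible_under (nlie_act B).

Definition nlie_rep_iso (F : fieldType) (k : nat) (V M M' : lmodType F)
    (B : ('I_k.+1 -> V * M) -> (V * M)%type)
    (B' : ('I_k.+1 -> V * M') -> (V * M')%type) : Prop :=
  exists phi : {linear M -> M'}, bijective phi /\
    forall z, B' (fun i => ((z i).1, phi (z i).2)) = ((B z).1, phi (B z).2).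

Definition alg_rep (F : fieldType) (A : algType F) (M : lmodType F)
    (s : A -> M -> M) : Prop :=
  [/\ forall u (c : F) m m', s u (c *: m + m') = c *: s u m + s u m',
      forall (c : F) u v m, s (c *: u + v) m = c *: s u m + s v m,
      forall m, s 1 m = m
    & forall u v m, s (u * v) m = s u (s v m)].

Definition irr_alg_rep (F : fieldType) (A : algType F) (M : lmodType F)
    (s : A -> M -> M) : Prop :=
  alg_rep s /\ irreducible_under s.

Definition alg_rep_iso (F : fieldType) (A : algType F) (M M' : lmodType F)
    (s : A -> M -> M) (s' : A -> M' -> M') : Prop :=
  exists phi : {linear M -> M'}, bijective phi /\
    forall u m, s' u (phi m) = phi (s u m).

Definition acts_trivially (F : fieldType) (A : algType F) (M : lmodType F)
    (s : A -> M -> M) (I : A -> Prop) : Prop :=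
  forall q m, I q -> s q m = 0.

Definition two_sided_ideal (A : pzRingType) (I : A -> Prop) : Prop :=
  [/\ I 0, forall x y, I x -> I y -> I (x + y),
      forall a x, I x -> I (a * x) & forall a x, I x -> I (x * a)].

Definition ideal_gen (A : pzRingType) (S : A -> Prop) : A -> Prop :=
  fun x => forall I, two_sided_ideal I -> (forall y, S y -> I y) -> I x.

Lemma ideal_genP (A : pzRingType) (S : A -> Prop) :
  two_sided_ideal (ideal_gen S).
Proof.
split=> [I [] //|x y hx hy I hI hS|a x hx I hI hS|a x hx I hI hS].
- by case: (hI) => _ hD _ _; apply: hD; [apply: hx|apply: hy].
- by case: (hI) => _ _ hM _; apply: hM; apply: hx.
- by case: (hI) => _ _ _ hM; apply: hM; apply: hx.
Qed.

Lemma ideal_gen_sub (A : pzRingType) (S : A -> Prop) x : S x -> ideal_gen S x.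
Proof. by move=> hx I _; apply. Qed.

(* Formal power series R[[x_0, .., x_(k-1)]]: families of coefficients indexed
   by the monomials 'X_{1..k}. *)

Record fps (R : comNzRingType) (k : nat) : Type :=
  FPS { fps_coef : 'X_{1..k} -> R }.

HB.instance Definition _ (R : comNzRingType) (k : nat) := gen_eqMixin (fps R k).
HB.instance Definition _ (R : comNzRingType) (k : nat) :=
  gen_choiceMixin (fps R k).

Section PowerSeries.
Context (R : comNzRingType) (k : nat).
Local Notation S := (fps R k).
Implicit Types (f g h : S) (p q : mpoly k R) (m : 'X_{1..k}).

Lemma fpsP f g : fps_coef f =1 fps_coef g -> f = g.
Proof. by case: f g => [f] [g] /= fg; congr FPS; apply/funext. Qed.

Definition fps_zero : S := FPS (fun=> 0).
Definition fps_one : S := FPS (fun m => (m == 0%MM)%:R).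
Definition fps_opp f : S := FPS (fun m => - fps_coef f m).
Definition fps_add f g : S := FPS (fun m => fps_coef f m + fps_coef g m).
Definition fps_scale (c : R) f : S := FPS (fun m => c * fps_coef f m).

(* The bound on the degrees only serves to make the index type finite. *)
Definition fps_mul f g : S := FPS (fun m =>
  \sum_(a : 'X_{1..k < (mdeg m).+1, (mdeg m).+1} | m == (a.1 + a.2)%MM)
    fps_coef f a.1 * fps_coef g a.2).

Definition agree d p f := forall m, (mdeg m < d)%N -> p@_m = fps_coef f m.

Definition fps_trunc d f : mpoly k R :=
  \sum_(m : 'X_{1..k < d}) fps_coef f m *: 'X_[m].

Lemma agree_trunc d f : agree d (fps_trunc d f) f.
Proof.
move=> m hm; rewrite /fps_trunc raddf_sum /= (bigD1 (BMultinom hm)) //=.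
rewrite mcoeffZ mcoeffX eqxx mulr1 big1 ?addr0 // => i ne.
rewrite mcoeffZ mcoeffX; case: eqP => [e|]; last by rewrite mulr0.
by case/eqP: ne; apply/val_inj.
Qed.

Lemma agreeM d p q f g : agree d p f -> agree d q g -> agree d (p * q) (fps_mul f g).
Proof.
move=> hf hg m hm; rewrite mcoeffM /=; apply: eq_bigr => a /eqP e.
have ed : mdeg m = (mdeg a.1 + mdeg a.2)%N by rewrite -mdegD -e.
by congr (_ * _); [apply: hf|apply: hg]; apply: leq_ltn_trans hm;
  rewrite [leqRHS]ed ?leq_addr ?leq_addl.
Qed.

Lemma agreeD d p q f g : agree d p f -> agree d q g -> agree d (p + q) (fps_add f g).
Proof. by move=> hf hg m hm; rewrite mcoeffD hf ?hg. Qed.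

Lemma agree1 d : agree d 1 fps_one.
Proof. by move=> m hm; rewrite mcoeff1. Qed.

Lemma agree_eq f g : (forall d, exists2 p, agree d p f & agree d p g) -> f = g.
Proof.
move=> h; apply: fpsP => m; have [p pf pg] := h (mdeg m).+1.
by rewrite -pf // pg.
Qed.

Lemma fps_addA : associative fps_add.
Proof. by move=> f g h; apply: fpsP => m /=; rewrite addrA. Qed.
Lemma fps_addC : commutative fps_add.
Proof. by move=> f g; apply: fpsP => m /=; rewrite addrC. Qed.
Lemma fps_add0 : left_id fps_zero fps_add.
Proof. by move=> f; apply: fpsP => m /=; rewrite add0r. Qed.
Lemma fps_addN : left_inverse fps_zero fps_opp fps_add.
Proof. by move=> f; apply: fpsP => m /=; rewrite addNr. Qed.

Lemma fps_mulA : associative fps_mul.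
Proof.
move=> f g h; apply: agree_eq => d.
have [[af ag] ah] := (@agree_trunc d f, @agree_trunc d g, @agree_trunc d h).
exists (fps_trunc d f * (fps_trunc d g * fps_trunc d h)).
  exact: agreeM af (agreeM ag ah).
by rewrite mulrA; exact: agreeM (agreeM af ag) ah.
Qed.

Lemma fps_mulC : commutative fps_mul.
Proof.
move=> f g; apply: agree_eq => d.
have [af ag] := (@agree_trunc d f, @agree_trunc d g).
exists (fps_trunc d f * fps_trunc d g); first exact: agreeM af ag.
by rewrite mulrC; exact: agreeM ag af.
Qed.

Lemma fps_mul1 : left_id fps_one fps_mul.
Proof.
move=> f; apply: agree_eq => d; exists (1 * fps_trunc d f).
  exact: agreeM (@agree1 d) (@agree_trunc d f).
by rewrite mul1r; exact: agree_trunc.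
Qed.

Lemma fps_mulDl : left_distributive fps_mul fps_add.
Proof.
move=> f g h; apply: agree_eq => d.
have [[af ag] ah] := (@agree_trunc d f, @agree_trunc d g, @agree_trunc d h).
exists ((fps_trunc d f + fps_trunc d g) * fps_trunc d h).
  exact: agreeM (agreeD af ag) ah.
by rewrite mulrDl; exact: agreeD (agreeM af ah) (agreeM ag ah).
Qed.

Lemma fps_oner_neq0 : fps_one != fps_zero.
Proof.
apply/eqP => /(congr1 (fun f => fps_coef f 0%MM)) /= /eqP.
by rewrite eqxx oner_eq0.
Qed.

HB.instance Definition _ := GRing.isZmodule.Build S
  fps_addA fps_addC fps_add0 fps_addN.
HB.instance Definition _ := GRing.Zmodule_isComNzRing.Build S
  fps_mulA fps_mulC fps_mul1 fps_mulDl fps_oner_neq0.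

Lemma fps_scaleA a b f : fps_scale a (fps_scale b f) = fps_scale (a * b) f.
Proof. by apply: fpsP => m /=; rewrite mulrA. Qed.
Lemma fps_scale1 : left_id 1 fps_scale.
Proof. by move=> f; apply: fpsP => m /=; rewrite mul1r. Qed.
Lemma fps_scaleDr : right_distributive fps_scale +%R.
Proof. by move=> a f g; apply: fpsP => m /=; rewrite mulrDr. Qed.
Lemma fps_scaleDl f : {morph fps_scale^~ f : a b / a + b}.
Proof. by move=> a b; apply: fpsP => m /=; rewrite mulrDl. Qed.

HB.instance Definition _ := GRing.Zmodule_isLmodule.Build R S
  fps_scaleA fps_scale1 fps_scaleDr fps_scaleDl.

Lemma fps_scaleAl (a : R) f g : a *: (f * g) = (a *: f) * g.
Proof.
apply: fpsP => m /=; rewrite mulr_sumr.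
by apply: eq_bigr => i _; rewrite mulrA.
Qed.

HB.instance Definition _ := GRing.Lmodule_isLalgebra.Build R S fps_scaleAl.
HB.instance Definition _ := GRing.Lalgebra_isComAlgebra.Build R S.

(* D_i = d / dx_i *)
Definition fps_D (i : 'I_k) f : S :=
  FPS (fun m => fps_coef f (m + U_(i))%MM *+ (m i).+1).

Lemma agree_D d i p f : agree d.+1 p f -> agree d p^`M(i) (fps_D i f).
Proof.
move=> hp m hm; rewrite mcoeff_deriv hp //.
by rewrite mdegD mdeg1 addn1.
Qed.

Lemma fps_DM i f g : fps_D i (f * g) = fps_D i f * g + f * fps_D i g.
Proof.
apply: agree_eq => d.
have wk e p h : agree e.+1 p h -> agree e p h by move=> H m /ltnW; apply: H.
have [af ag] := (@agree_trunc d.+1 f, @agree_trunc d.+1 g).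
exists (fps_trunc d.+1 f * fps_trunc d.+1 g)^`M(i).
  exact/agree_D/agreeM.
rewrite mderivM; apply: agreeD; apply: agreeM; by [exact: agree_D|exact: wk].
Qed.

Lemma fps_D_linear i : linear (fps_D i).
Proof. by move=> a f g; apply: fpsP => m /=; rewrite mulrnDl mulrnAr. Qed.

HB.instance Definition _ i := GRing.isLinear.Build R S S *:%R (fps_D i)
  (fps_D_linear i).

Lemma fps_DC i j f : fps_D i (fps_D j f) = fps_D j (fps_D i f).
Proof.
apply: fpsP => m /=; rewrite !mnmE -addmA [(U_(i) + _)%MM]addmC addmA -!mulrnA.
by congr (_ *+ _); rewrite eq_sym; case: eqP => [->|_];
  rewrite ?addn0 ?addn1 // mulnC.
Qed.

(* The Lie algebra of the derivations \sum_i X_i D_i of the power series in k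
   variables, which are encoded by the coefficients X. *)

Definition vf : Type := {ffun 'I_k -> S}.
HB.instance Definition _ := GRing.Lmodule.on vf.

Definition vf_der (X : vf) f : S := \sum_(i < k) X i * fps_D i f.

Definition vf_br (X Y : vf) : vf :=
  [ffun j => \sum_(i < k) (X i * fps_D i (Y j) - Y i * fps_D i (X j))].

Lemma vf_brE X Y f :
  vf_der (vf_br X Y) f = vf_der X (vf_der Y f) - vf_der Y (vf_der X f).
Proof.
have derE (U Z : vf) : vf_der U (vf_der Z f) =
    \sum_(j < k) \sum_(i < k) U i * fps_D i (Z j) * fps_D j f +
    \sum_(j < k) \sum_(i < k) U i * Z j * fps_D i (fps_D j f).
  rewrite -big_split /= [RHS](eq_bigr _ (fun j _ => esym (big_split _ _ _ _ _))) [RHS]exchange_big /=.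
  apply: eq_bigr => i _; rewrite raddf_sum mulr_sumr /=; apply: eq_bigr => j _.
  by rewrite fps_DM mulrDr !mulrA.
rewrite !derE [X in _ = _ + X - _]exchange_big /=.
rewrite [X in _ = X - _]addrC [X in _ = _ - X]addrC opprD addrACA -[LHS]add0r.
congr (_ + _).
  apply/esym/eqP; rewrite subr_eq0; apply/eqP.
  apply: eq_bigr => i _; apply: eq_bigr => j _.
  by rewrite fps_DC [X i * _]mulrC.
rewrite -sumrB; apply: eq_bigr => j _; rewrite ffunE mulr_suml -sumrB.
by apply: eq_bigr => i _; rewrite mulrBl.
Qed.

(* The bracket of W^n, where n = k + 1. *)

Definition W_br (f : 'I_k.+1 -> S) : S :=
  \det (\matrix_(r < k.+1, c < k.+1)
    if unlift ord0 r is Some i then fps_D i (f c) else f c).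
End PowerSeries.

Section InnerDerivations.
Context (R : comNzRingType) (p : nat).

(* Here n = p + 2, so that there are p + 1 variables. The rows are (f_c)_c and
   (D_j f_c)_c for j != i in increasing order. *)
Definition Delta (f : 'I_p.+1 -> fps R p.+1) (i : 'I_p.+1) : fps R p.+1 :=
  \det (\matrix_(r < p.+1, c < p.+1)
    if unlift ord0 r is Some j then fps_D (lift i j) (f c) else f c).

(* The derivation identified with ad (f_1 /\ .. /\ f_(n-1)). As i counts from 0,
   the sign (-1)^(n+1-i) reads (-1)^(n-i). *)
Definition adW (f : 'I_p.+1 -> fps R p.+1) : vf R p.+1 :=
  [ffun i : 'I_p.+1 => (-1) ^+ (p.+2 - i) * Delta f i].

(* The identification ad (f_1 /\ .. /\ f_(n-1)) |-> adW f amounts to dropping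
   the term of order 0 of the differential operator ad (f_1 /\ .. /\ f_(n-1)). *)
Lemma W_br_adW (f : 'I_p.+1 -> fps R p.+1) (b : fps R p.+1) :
  W_br (frcons f b) = vf_der (adW f) b +
    (-1) ^+ p.+1 * \det (\matrix_(i < p.+1, c < p.+1) fps_D i (f c)) * b.
Proof.
have frl (c : 'I_p.+1) : frcons f b (lift ord_max c) = f c.
  by rewrite /frcons liftK.
have frm : frcons f b ord_max = b by rewrite /frcons unlift_none.
rewrite /W_br (expand_det_col _ ord_max) big_ord_recl /= addrC.
congr (_ + _).
  apply: eq_bigr => i _; rewrite mxE liftK frm ffunE mulrC; congr (_ * _).
  rewrite /cofactor; congr (_ * _).
    rewrite lift0 /= -signr_odd -[RHS]signr_odd; congr (_ ^+ _).
    rewrite oddB ?(leqW (ltnW (ltn_ord i))) //= oddD /=.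
    by case: (odd i); case: (odd p).
  congr (\det _); apply/matrixP => r c; rewrite !mxE frl.
  case: (unliftP ord0 r) => [j ->|->].
    have -> : lift (lift ord0 i) (lift ord0 j) = lift ord0 (lift i j).
      by apply/val_inj; rewrite /= /bump /= !add1n ltnS addnS.
    by rewrite liftK.
  have -> : lift (lift ord0 i) ord0 = ord0 :> 'I_p.+2 by apply/val_inj.
  by rewrite unlift_none.
rewrite mxE unlift_none frm mulrC; congr (_ * _).
rewrite /cofactor; congr (_ * \det _).
by apply/matrixP => r c; rewrite !mxE liftK frl.
Qed.
End InnerDerivations.

(* The universal enveloping algebra of a Lie algebra (L, br): the quotient of
   the free associative algebra on the set L (the algebra of the monoid of words
   in L) by the relations below, the first of which cut it down to T(L). *)

Section EnvelopingAlgebra.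
Context (F : fieldType) (L : lmodType F) (br : L -> L -> L).

Definition free_alg : Type := {malg F[{fmonom L}]}.
HB.instance Definition _ := GRing.Lalgebra.on free_alg.

Definition free_gen (x : L) : free_alg := mkmalgU (fmu x) 1.

Definition uea_rel (z : free_alg) : Prop :=
  (exists (c : F) (x y : L),
     z = free_gen (c *: x + y) - (c *: free_gen x + free_gen y)) \/
  (exists x y : L,
     z = free_gen x * free_gen y - free_gen y * free_gen x - free_gen (br x y)).

Local Notation I := (ideal_gen uea_rel).

Lemma uea_ideal0 : I 0. Proof. by case: (ideal_genP uea_rel). Qed.
Lemma uea_idealD x y : I x -> I y -> I (x + y).
Proof. by case: (ideal_genP uea_rel) => _ + _ _; apply. Qed.
Lemma uea_idealMl a x : I x -> I (a * x).
Proof. by case: (ideal_genP uea_rel) => _ _ + _; apply. Qed.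
Lemma uea_idealMr a x : I x -> I (x * a).
Proof. by case: (ideal_genP uea_rel) => _ _ _; apply. Qed.
Lemma uea_idealN x : I x -> I (- x).
Proof. by move=> hx; rewrite -mulN1r; apply: uea_idealMl. Qed.
Lemma uea_idealZ (c : F) x : I x -> I (c *: x).
Proof. by move=> hx; rewrite -[x]mul1r scalerAl; apply: uea_idealMl. Qed.

Definition uea_eqv (x y : free_alg) : bool := `[< I (x - y) >].

Lemma uea_eqv_class : equiv_class_of uea_eqv.
Proof.
split=> [x|x y|y x z].
- by apply/asboolP; rewrite subrr; exact: uea_ideal0.
- by apply/asboolP/asboolP => /uea_idealN; rewrite opprB.
- move=> /asboolP xy /asboolP yz; apply/asboolP.
  by rewrite -[x](subrK y) -addrA; apply: uea_idealD.
Qed.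
Canonical uea_eqv_equiv := EquivRelPack uea_eqv_class.

Definition uea : Type := {eq_quot uea_eqv}%qT.
HB.instance Definition _ := Choice.on uea.
HB.instance Definition _ : EqQuotient free_alg uea_eqv uea := EqQuotient.on uea.

Local Notation pi := (\pi_uea)%qT.

Lemma uea_piP x y : reflect (I (x - y)) (pi x == pi y).
Proof. by rewrite piE; apply/asboolP. Qed.
Lemma uea_pi x y : I (x - y) -> pi x = pi y.
Proof. by move=> h; apply/eqP/uea_piP. Qed.
Lemma uea_reprK (u : uea) : pi (repr u) = u. Proof. exact: reprK. Qed.
Lemma uea_repr x : I (repr (pi x) - x).
Proof. by apply/uea_piP; rewrite uea_reprK. Qed.

Definition uea_add (u v : uea) : uea := pi (repr u + repr v).
Definition uea_opp (u : uea) : uea := pi (- repr u).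
Definition uea_mul (u v : uea) : uea := pi (repr u * repr v).
Definition uea_scale (c : F) (u : uea) : uea := pi (c *: repr u).

Lemma uea_piD x y : uea_add (pi x) (pi y) = pi (x + y).
Proof.
apply: uea_pi; rewrite opprD addrACA.
by apply: uea_idealD; exact: uea_repr.
Qed.
Lemma uea_piN x : uea_opp (pi x) = pi (- x).
Proof. by apply: uea_pi; rewrite -opprD; apply: uea_idealN; exact: uea_repr. Qed.
Lemma uea_piM x y : uea_mul (pi x) (pi y) = pi (x * y).
Proof.
apply: uea_pi; rewrite -[_ - _](subrKA (repr (pi x) * y)) -mulrBr -mulrBl.
apply: uea_idealD; first by apply: uea_idealMl; exact: uea_repr.
by apply: uea_idealMr; exact: uea_repr.
Qed.
Lemma uea_piZ c x : uea_scale c (pi x) = pi (c *: x).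
Proof. by apply: uea_pi; rewrite -scalerBr; apply: uea_idealZ; exact: uea_repr. Qed.

Lemma uea_ind (P : uea -> Prop) : (forall x, P (pi x)) -> forall u, P u.
Proof. by move=> h u; rewrite -[u]uea_reprK. Qed.

Lemma uea_addA : associative uea_add.
Proof.
by elim/uea_ind=> x; elim/uea_ind=> y; elim/uea_ind=> z; rewrite !uea_piD addrA.
Qed.
Lemma uea_addC : commutative uea_add.
Proof. by elim/uea_ind=> x; elim/uea_ind=> y; rewrite !uea_piD addrC. Qed.
Lemma uea_add0 : left_id (pi 0) uea_add.
Proof. by elim/uea_ind=> x; rewrite uea_piD add0r. Qed.
Lemma uea_addN : left_inverse (pi 0) uea_opp uea_add.
Proof. by elim/uea_ind=> x; rewrite uea_piN uea_piD addNr. Qed.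
HB.instance Definition _ := GRing.isZmodule.Build uea
  uea_addA uea_addC uea_add0 uea_addN.

Lemma uea_mulA : associative uea_mul.
Proof.
by elim/uea_ind=> x; elim/uea_ind=> y; elim/uea_ind=> z; rewrite !uea_piM mulrA.
Qed.
Lemma uea_mul1l : left_id (pi 1) uea_mul.
Proof. by elim/uea_ind=> x; rewrite uea_piM mul1r. Qed.
Lemma uea_mul1r : right_id (pi 1) uea_mul.
Proof. by elim/uea_ind=> x; rewrite uea_piM mulr1. Qed.
Lemma uea_mulDl : left_distributive uea_mul uea_add.
Proof.
elim/uea_ind=> x; elim/uea_ind=> y; elim/uea_ind=> z.
by rewrite uea_piD !uea_piM uea_piD mulrDl.
Qed.
Lemma uea_mulDr : right_distributive uea_mul uea_add.
Proof.
elim/uea_ind=> x; elim/uea_ind=> y; elim/uea_ind=> z.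
by rewrite uea_piD !uea_piM uea_piD mulrDr.
Qed.
Local Notation aug := (monalg.mcoeff (@monalg.one {fmonom L})).
Lemma uea_oner_neq0 : pi 1 != pi 0.
Proof.
apply/uea_piP => /(_ (fun z : free_alg => aug z = 0)).
have e0 x : aug (free_gen x) = 0.
  by rewrite monalg.mcoeffU; case: eqP => // /(congr1 (@fdeg L)); rewrite fdegU fdeg1.
have eM (y z : free_alg) : aug (y * z) =
  aug y * aug z by exact: rmorphM.
rewrite subr0 monalg.mcoeff1 eqxx => h.
suff /eqP : (1 : F) = 0 by rewrite oner_eq0.
apply: h.
  split=> [|x y hx hy|a x hx|a x hx]; first exact: monalg.mcoeff0.
  - by rewrite monalg.mcoeffD hx hy addr0.
  - by rewrite eM hx mulr0.
  - by rewrite eM hx mul0r.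
move=> z [[c [x [y ->]]]|[x [y ->]]].
  by rewrite monalg.mcoeffB monalg.mcoeffD monalg.mcoeffZ !e0 mulr0 addr0 subrr.
by rewrite !monalg.mcoeffB !eM !e0 !mulr0 !subrr.
Qed.
HB.instance Definition _ := GRing.Zmodule_isNzRing.Build uea
  uea_mulA uea_mul1l uea_mul1r uea_mulDl uea_mulDr uea_oner_neq0.

Lemma uea_scaleA a b u : uea_scale a (uea_scale b u) = uea_scale (a * b) u.
Proof. by elim/uea_ind: u => x; rewrite !uea_piZ scalerA. Qed.
Lemma uea_scale1 : left_id 1 uea_scale.
Proof. by elim/uea_ind=> x; rewrite uea_piZ scale1r. Qed.
Lemma uea_scaleDr : right_distributive uea_scale +%R.
Proof.
have eD (a b : free_alg) : pi a + pi b = pi (a + b) by exact: uea_piD.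
move=> c; elim/uea_ind=> x; elim/uea_ind=> y.
by rewrite eD !uea_piZ eD scalerDr.
Qed.
Lemma uea_scaleDl u : {morph uea_scale^~ u : a b / a + b}.
Proof.
move=> a b; elim/uea_ind: u => x; rewrite !uea_piZ scalerDl.
by rewrite [RHS]uea_piD.
Qed.
HB.instance Definition _ := GRing.Zmodule_isLmodule.Build F uea
  uea_scaleA uea_scale1 uea_scaleDr uea_scaleDl.

Lemma uea_scaleAl (c : F) (u v : uea) : c *: (u * v) = (c *: u) * v.
Proof.
elim/uea_ind: u => x; elim/uea_ind: v => y.
rewrite [LHS](congr1 (uea_scale c) (uea_piM x y)) uea_piZ scalerAl.
by rewrite [RHS](congr1 (uea_mul^~ _) (uea_piZ c x)) uea_piM.
Qed.
HB.instance Definition _ := GRing.Lmodule_isLalgebra.Build F uea uea_scaleAl.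

Lemma free_scaleAr (c : F) (x y : free_alg) : c *: (x * y) = x * (c *: y).
Proof.
have eZ (d : F) (z : free_alg) : d *: z = malgC d * z by rewrite mul_malgC.
rewrite !eZ mulrA [RHS]mulrA; congr (_ * _).
rewrite !malgM_def fgmulUg fgmulgU; apply: eq_bigr => k _.
by rewrite monalg.mul1m monalg.mulm1 mulrC.
Qed.

Lemma uea_scaleAr (c : F) (u v : uea) : c *: (u * v) = u * (c *: v).
Proof.
elim/uea_ind: u => x; elim/uea_ind: v => y.
rewrite [LHS](congr1 (uea_scale c) (uea_piM x y)) uea_piZ free_scaleAr.
by rewrite [RHS](congr1 (uea_mul _) (uea_piZ c y)) uea_piM.
Qed.
HB.instance Definition _ := GRing.Lalgebra_isAlgebra.Build F uea uea_scaleAr.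

(* the canonical map L -> U(L) *)
Definition uea_gen (x : L) : uea := pi (free_gen x).
End EnvelopingAlgebra.


Section Correspondence.
Context (F : fieldType) (p : nat).

Local Notation W := (fps F p.+1).
Local Notation U := (uea (@vf_br F p.+1)).

Definition ad_uea (f : 'I_p.+1 -> W) : U := uea_gen (@vf_br F p.+1) (adW f).

(* x_{a_1, .., a_{2n-2}}, where u = (a_{n+1}, .., a_{2n-2}) *)
Definition xW (a : 'I_p.+2 -> W) (u : 'I_p -> W) : U :=
  ad_uea (fcons (W_br a) u) -
  \sum_(i < p.+2) (-1) ^+ (i.+1 + p.+2) *
    (ad_uea (fun j : 'I_p.+1 => a (lift i j)) * ad_uea (fcons (a i) u)).

Definition QW : U -> Prop := ideal_gen (fun z => exists a u, z = xW a u).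

(* The correspondence between the two kinds of representations on a space M:
   [f_1, .., f_{n-1}, m] = ad (f_1 /\ .. /\ f_{n-1}) m *)
Definition corresponding (M : lmodType F)
    (B : ('I_p.+2 -> W * M) -> (W * M)%type) (s : U -> M -> M) : Prop :=
  forall f m, nlie_act B f m = s (ad_uea f) m.
End Correspondence.

(* Main.v *)
Require Import Defs.
From mathcomp Require Import all_boot all_order all_algebra perm fingroup.
From mathcomp Require Import boolp finmap.
From mathcomp Require Import monalg mpoly ring.

Set Implicit Arguments.
Unset Strict Implicit.
Unset Printing Implicit Defensive.

Import GRing.Theory.
Local Open Scope ring_scope.

(** Let M be a representation of W^n and write rho f for the operator
    m |-> [f_1, .., f_(n-1), m]. Expanding the arguments in W + M shows that rho
    determines the bracket ([nlie_repE]), and that the Filippov identity amounts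
    to two conditions on rho ([nlie_rep_action], [action_ext_rep]): the
    commutator of rho a and rho b is the sum of the rho (b_1, .., ad a b_i, ..),
    and the operators attached to the elements x_(a_1, .., a_(2n-2)) vanish. So
    one has to show that rho f depends only on the vector field adW f: rho is
    then an action of the Lie algebra W_(n-1), that is, of its enveloping
    algebra. In the other direction the two conditions are the defining
    relations of the enveloping algebra and of the ideal, once ad f is known to
    be determined by adW f and the commutator of ad a and ad b to be given by the
    Leibniz rule. Both hold because ad f is the action of adW f on densities of
    weight -1/(n-1) ([W_br_act]), and the bracket of W^n, a determinant, is
    invariant under every vector field acting in this way ([vf_act_W_br]).

    The dependence on adW f is [lie_action_adW], and is deduced from the commutators.
    Up to a volume form, adW f is the differential form of degree n - 2 that is
    the alternating sum of the f_i df_1 .. df_(n-1), with df_i omitted; and every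
    vector field is a sum of forms h dx_1 .. dx_(n-1), with dx_l omitted
    ([vf_normal_form]). Let E f be the difference between rho f and the operator
    read off from this normal form of adW f. It is multilinear, alternating, it
    vanishes on the forms h dx_1 .. dx_(n-1), and if X.E denotes E with X applied
    to its arguments in turn, then (adW a).E (b) = - (adW b).E (a), both sides
    coming from commutators. Such an E is zero ([form_vanish]).

    Indeed, antisymmetry makes (X.E)(b) a function of adW b, so that every linear
    relation between vector fields adW b holds between the values of X.E
    ([slotwise_act_factor]). This is applied to the relation
    g df = sum of (g D_k f) dx_k, in which the remaining n - 3 differentials are
    those of coordinates. Let theta (g, f) be the difference of the values of E
    on its two sides. Two coordinates do not occur among these differentials; for
    affine X along them the relation for X.E says that theta is invariant
    under D_i and x_i D_j, and that x_i D_i acts on it by its divergence 1.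
    Since D_j is onto, the first two facts give
    theta (x_i g, f) = theta (g, x_i f); with invariance under D_i this makes
    x_i D_i act by -1. Hence 2 theta = 0. So E vanishes on the forms
    g df dx_3 .. dx_(n-1), hence X.E = 0 whenever X has no divergence
    ([slotwise_act_div0]). Such fields take a coordinate to an arbitrary function
    while fixing other coordinates, and this allows to replace the remaining
    coordinates by arbitrary functions ([dform_vanish]). *)

(** * Multilinear alternating maps on lists of arguments *)

Section LinearMaps.
Context (R : comNzRingType) (V N : lmodType R) (T : V -> N).
Hypothesis TL : forall c x y, T (c *: x + y) = c *: T x + T y.

Lemma linear_map0 : T 0 = 0.
Proof.
by apply: (@addrI _ (T 0)); have := TL 1 0 0; rewrite !scale1r !addr0 => <-.
Qed.

Lemma linear_mapD x y : T (x + y) = T x + T y.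
Proof. by rewrite -[x in LHS]scale1r TL scale1r. Qed.

Lemma linear_map_sum (J : Type) (r : seq J) (P : pred J) (G : J -> V) :
  T (\sum_(j <- r | P j) G j) = \sum_(j <- r | P j) T (G j).
Proof. exact: (big_morph T linear_mapD linear_map0). Qed.
End LinearMaps.

Section Update.
Context (I : eqType) (T : Type).
Implicit Types (a : I -> T) (i j : I) (x y : T).

Definition upd a i x : I -> T := fun j => if j == i then x else a j.

Lemma upd_same a i x : upd a i x i = x.
Proof. by rewrite /upd eqxx. Qed.

Lemma upd_other a i x j : j != i -> upd a i x j = a j.
Proof. by rewrite /upd => /negbTE->. Qed.

Lemma upd_id a i : upd a i (a i) = a.
Proof. by apply/funext => j; rewrite /upd; case: eqP => [->|]. Qed.

Lemma upd_idem a i x y : upd (upd a i x) i y = upd a i y.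
Proof. by apply/funext => j; rewrite /upd; case: eqP. Qed.

Lemma updC a i j x y : i != j -> upd (upd a i x) j y = upd (upd a j y) i x.
Proof.
move=> ij; apply/funext => l; rewrite /upd.
by case: (eqVneq l j) => [->|//]; rewrite eq_sym (negbTE ij).
Qed.
End Update.

Lemma comp_upd (I : eqType) (T T' : Type) (h : T -> T') (a : I -> T) i x :
  (fun j => h (upd a i x j)) = upd (fun j => h (a j)) i (h x).
Proof. by apply/funext => j; rewrite /upd; case: eqP. Qed.

Section ConsUpdate.
Context (T : Type) (k : nat).
Implicit Types (a : 'I_k -> T) (b : 'I_k.+1 -> T) (x y : T).

Lemma fcons0 x a : fcons x a ord0 = x.
Proof. by rewrite /fcons unlift_none. Qed.
Lemma fcons_lift x a j : fcons x a (lift ord0 j) = a j.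
Proof. by rewrite /fcons liftK. Qed.
Lemma frcons_max a x : frcons a x ord_max = x.
Proof. by rewrite /frcons unlift_none. Qed.
Lemma frcons_lift a x j : frcons a x (lift ord_max j) = a j.
Proof. by rewrite /frcons liftK. Qed.

Lemma fcons_upd x a i y : fcons x (upd a i y) = upd (fcons x a) (lift ord0 i) y.
Proof.
apply/funext => j; case: (unliftP ord0 j) => [j' ->|->].
  by rewrite /upd !fcons_lift (inj_eq lift_inj).
by rewrite fcons0 upd_other ?fcons0 // neq_lift.
Qed.

Lemma fcons_upd0 x a y : fcons y a = upd (fcons x a) ord0 y.
Proof.
apply/funext => j; case: (unliftP ord0 j) => [j' ->|->].
  by rewrite upd_other ?fcons_lift // eq_sym neq_lift.
by rewrite upd_same fcons0.
Qed.

Lemma frcons_upd a i x y :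
  frcons (upd a i x) y = upd (frcons a y) (lift ord_max i) x.
Proof.
apply/funext => j; case: (unliftP ord_max j) => [j' ->|->].
  by rewrite /upd !frcons_lift (inj_eq lift_inj).
by rewrite frcons_max upd_other ?frcons_max // neq_lift.
Qed.

Lemma frcons_upd_max a x y : frcons a y = upd (frcons a x) ord_max y.
Proof.
apply/funext => j; case: (unliftP ord_max j) => [j' ->|->].
  by rewrite upd_other ?frcons_lift // eq_sym neq_lift.
by rewrite upd_same frcons_max.
Qed.

Lemma fcons_eta b : fcons (b ord0) (fun j => b (lift ord0 j)) = b.
Proof.
apply/funext => j; case: (unliftP ord0 j) => [j' ->|->].
  by rewrite fcons_lift.
by rewrite fcons0.
Qed.

Lemma upd_lift b i y : (fun j => upd b i y (lift i j)) = (fun j => b (lift i j)).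
Proof. by apply/funext => j; rewrite upd_other // eq_sym neq_lift. Qed.

Lemma upd_lift_lift b i l y :
  (fun j => upd b (lift i l) y (lift i j)) = upd (fun j => b (lift i j)) l y.
Proof. by apply/funext => j; rewrite /upd (inj_eq lift_inj). Qed.
End ConsUpdate.

Section Multilinear.
Context (R : comNzRingType) (V N : lmodType R) (k : nat).
Implicit Types (br : ('I_k -> V) -> N) (a : 'I_k -> V).

Definition multilinear br : Prop := forall a i (c : R) x y,
  br (upd a i (c *: x + y)) = c *: br (upd a i x) + br (upd a i y).

Definition alternating br : Prop :=
  forall a i j, i != j -> a i = a j -> br a = 0.

Section Theory.
Variable br : ('I_k -> V) -> N.
Hypothesis brL : multilinear br.

Lemma multilinearD a i x y :
  br (upd a i (x + y)) = br (upd a i x) + br (upd a i y).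
Proof. by rewrite -[x in LHS]scale1r brL scale1r. Qed.

Lemma multilinear0 a i : br (upd a i 0) = 0.
Proof.
have := multilinearD a i 0 0; rewrite addr0 -[X in X = _]addr0.
by move/addrI.
Qed.

Lemma multilinearZ a i c x : br (upd a i (c *: x)) = c *: br (upd a i x).
Proof. by rewrite -[c *: x]addr0 brL multilinear0 addr0. Qed.

Lemma multilinearN a i x : br (upd a i (- x)) = - br (upd a i x).
Proof. by rewrite -scaleN1r multilinearZ scaleN1r. Qed.

Lemma multilinear_sum (J : Type) (r : seq J) (P : pred J) (x : J -> V) a i :
  br (upd a i (\sum_(j <- r | P j) x j)) =
  \sum_(j <- r | P j) br (upd a i (x j)).
Proof.
elim/big_rec2: _ => [|j y z _ <-]; first exact: multilinear0.
by rewrite multilinearD.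
Qed.

Hypothesis brA : alternating br.

Lemma alternating_swap a i j x y : i != j ->
  br (upd (upd a i x) j y) = - br (upd (upd a i y) j x).
Proof.
move=> ij; apply/eqP; rewrite -addr_eq0; apply/eqP.
have z w : br (upd (upd a i w) j w) = 0.
  by apply: (brA ij); rewrite upd_same upd_other ?upd_same.
have half u : br (upd (upd a i (x + y)) j u) =
    br (upd (upd a i x) j u) + br (upd (upd a i y) j u).
  by rewrite !(updC a _ _ ij) multilinearD.
have := z (x + y); rewrite multilinearD !half !z add0r addr0 => e.
by rewrite addrC e.
Qed.

Lemma alternating_tperm a i j : i != j ->
  br (fun l => a (tperm i j l)) = - br a.
Proof.
move=> ij; rewrite -{2}(upd_id a j) -{2}(upd_id a i) alternating_swap // opprK.
congr br; apply/funext => l; rewrite /upd.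
by case: tpermP => [->|->|/eqP/negbTE-> /eqP/negbTE->]; rewrite ?eqxx ?(negbTE ij).
Qed.

Lemma alternating_perm a (s : {perm 'I_k}) :
  br (fun l => a (s l)) = (-1) ^+ s *: br a.
Proof.
have [ts -> ] := prod_tpermP s; elim: ts a => [|t ts IH] a /= => [_|].
  rewrite big_nil odd_perm1 expr0 scale1r.
  by congr br; apply/funext => l; rewrite perm1.
case/andP => dt dts; rewrite big_cons odd_mul_tperm (dt : t.1 != t.2) signr_addb expr1.
rewrite mulN1r scaleNr -(IH _ dts) -(alternating_tperm _ dt).
by congr br; apply/funext => l; rewrite permM.
Qed.
End Theory.
End Multilinear.

Section AlternatingCons.
Context (R : comNzRingType) (V N : lmodType R) (k : nat).
Variable br : ('I_k.+1 -> V) -> N.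
Hypotheses (brL : multilinear br) (brA : alternating br).

(** lift_perm ord_max i 1 is the cycle that moves the slot i to the end; it has
    the parity of i + k. *)
Lemma alternating_frcons (a : 'I_k.+1 -> V) i x :
  br (frcons (fun j => a (lift i j)) x) = (-1) ^+ (i + k) *: br (upd a i x).
Proof.
rewrite -signr_odd oddD addbC -[odd k](congr1 odd (erefl (val (@ord_max k)))).
have e := odd_lift_perm ord_max i (1%g : 'S_k); rewrite odd_perm1 addbF in e.
rewrite -e -alternating_perm //; congr br; apply/funext => j.
case: (unliftP ord_max j) => [j' ->|->].
  by rewrite frcons_lift lift_perm_lift perm1 upd_other // eq_sym neq_lift.
by rewrite frcons_max lift_perm_id upd_same.
Qed.

Lemma alternating_fcons_frcons (a : 'I_k -> V) x :
  br (fcons x a) = (-1) ^+ k *: br (frcons a x).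
Proof.
have := alternating_frcons (fcons x a) ord0 x.
rewrite add0n -fcons_upd0 => e.
rewrite (_ : (fun j => _) = a) in e; last by apply/funext => j; rewrite fcons_lift.
by rewrite e scalerA -exprMn mulrNN mulr1 expr1n scale1r.
Qed.
End AlternatingCons.

Section ReindexVanish.
Context (R : comNzRingType) (V N : lmodType R) (k : nat).
Variable br : ('I_k -> V) -> N.
Hypotheses (brL : multilinear br) (brA : alternating br).

(** Any map from k slots to k.+1 vectors misses one of the vectors, so that it
    either repeats a vector or permutes the remaining ones. *)
Lemma alternating_reindex0 (y : 'I_k.+1 -> V) (phi : 'I_k -> 'I_k.+1) :
  (forall l : 'I_k.+1, br (fun j => y (lift l j)) = 0) -> br (fun j => y (phi j)) = 0.
Proof.
move=> y0.
have [l hl] : exists l, l \notin codom phi.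
  apply/existsP; rewrite -negb_forall; apply/negP => /forallP h.
  have : (#|'I_k.+1| <= size (codom phi))%N.
    rewrite cardE; apply: uniq_leq_size (enum_uniq _) _ => x _.
    by exact: h.
  by rewrite size_codom !card_ord ltnn.
have ne j : l != phi j by apply: contra hl => /eqP->; exact: codom_f.
have [psi hpsi] : exists psi : 'I_k -> 'I_k, forall j, phi j = lift l (psi j).
  exists (fun j => sval (unlift_some (ne j))) => j.
  by case: (unlift_some (ne j)) => x.
have [/injectiveP inj|/injectivePn[i [j ij e]]] := boolP (injectiveb psi).
  transitivity (br (fun j => (fun t => y (lift l t)) (perm inj j))).
    by congr br; apply/funext => j; rewrite permE hpsi.
  by rewrite (alternating_perm brL brA (fun t => y (lift l t))) y0 scaler0.
by apply: (brA ij); rewrite !hpsi e.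
Qed.
End ReindexVanish.

(** * Determinants as functions of their columns *)

Section ColumnDeterminant.
Context (A : comNzRingType) (n : nat).
Implicit Types (v : 'I_n -> 'cV[A]_n) (M : 'M[A]_n).

Definition cols v : 'M[A]_n := \matrix_(r, c) v c r ord0.

Definition detc v : A^o := \det (cols v).

Lemma detc_multilinear : multilinear detc.
Proof.
have detT w : detc w = \det (cols w)^T by rewrite det_tr.
move=> v i c x y; rewrite !detT.
rewrite (@determinant_multilinear _ _ _ (cols (upd v i x))^T
  (cols (upd v i y))^T i c 1) ?mul1r //.
- by rewrite scale1r; apply/rowP => j; rewrite !mxE !upd_same !mxE.
- by apply/matrixP => r l; rewrite !mxE !upd_other // eq_sym neq_lift.
- by apply/matrixP => r l; rewrite !mxE !upd_other // eq_sym neq_lift.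
Qed.

Lemma detc_alternating : alternating detc.
Proof.
move=> v i j ij e; rewrite /detc -det_tr (determinant_alternate ij) // => l.
by rewrite !mxE e.
Qed.

Lemma cofactor_cols_upd v c w r :
  cofactor (cols (upd v c w)) r c = cofactor (cols v) r c.
Proof.
rewrite /cofactor; congr (_ * \det _); apply/matrixP => s l.
by rewrite !mxE upd_other // eq_sym neq_lift.
Qed.

Lemma detc_upd v c w :
  detc (upd v c w) = \sum_r w r ord0 * cofactor (cols v) r c.
Proof.
rewrite [LHS](expand_det_col _ c); apply: eq_bigr => r _.
by rewrite cofactor_cols_upd mxE upd_same.
Qed.

(** The infinitesimal form of the multiplicativity of the determinant: both sides
    are tr (M A adj A), where A has the columns v. *)
Lemma detc_trace M v :
  \sum_c detc (upd v c (M *m v c)) = \tr M * detc v.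
Proof.
transitivity (\tr (M *m (cols v *m \adj (cols v)))); last first.
  by rewrite mul_mx_adj mul_mx_scalar mxtraceZ mulrC.
rewrite mulmxA /mxtrace; under [RHS]eq_bigr do rewrite mxE.
rewrite [RHS]exchange_big /=.
apply: eq_bigr => c _; rewrite detc_upd; apply: eq_bigr => r _.
rewrite !mxE; congr (_ * _).
by apply: eq_bigr => s _; rewrite !mxE.
Qed.

(** Laplace expansion along the row r, the minors being written as determinants
    of the same size. *)
Lemma detc_row r v :
  detc v = \sum_c v c r ord0 * detc (upd v c (delta_mx r ord0)).
Proof.
rewrite [LHS](expand_det_row _ r); apply: eq_bigr => c _; rewrite mxE.
congr (_ * _); rewrite detc_upd (bigD1 r) //= mxE !eqxx mul1r big1 ?addr0 //.
by move=> s /negbTE sr; rewrite mxE sr mul0r.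
Qed.

Section Derivation.
Variable d : A -> A.
Hypotheses (dD : forall x y, d (x + y) = d x + d y)
  (dM : forall x y, d (x * y) = d x * y + x * d y).

Lemma derivation0 : d 0 = 0.
Proof. by apply: (@addrI _ (d 0)); rewrite -dD !addr0. Qed.

Lemma derivation1 : d 1 = 0.
Proof.
by apply: (@addrI _ (d 1)); rewrite addr0 -[in RHS](mul1r 1) dM mulr1 mul1r.
Qed.

Lemma derivationN x : d (- x) = - d x.
Proof. by apply/eqP; rewrite -addr_eq0 -dD addNr derivation0. Qed.

Lemma derivation_sum (J : Type) (r : seq J) (P : pred J) (F : J -> A) :
  d (\sum_(j <- r | P j) F j) = \sum_(j <- r | P j) d (F j).
Proof. by apply: (big_morph d); [exact: dD|exact: derivation0]. Qed.

Lemma derivation_prod (k : nat) (F : 'I_k -> A) :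
  d (\prod_i F i) = \sum_i \prod_j upd F i (d (F i)) j.
Proof.
elim: k F => [|k IH] F; first by rewrite !big_ord0 derivation1.
rewrite big_ord_recl dM IH [RHS]big_ord_recl; congr (_ + _).
  by rewrite big_ord_recl upd_same; congr (_ * _); apply: eq_bigr.
rewrite mulr_sumr; apply: eq_bigr => i _.
by rewrite big_ord_recl upd_other ?neq_lift //; congr (_ * _).
Qed.

Lemma derivation_detc v :
  d (detc v) = \sum_c detc (upd v c (map_mx d (v c))).
Proof.
have detE w : detc w = \sum_(s : 'S_n) (-1) ^+ s * \prod_i w i (s i) ord0.
  rewrite /detc -det_tr; apply: eq_bigr => s _; congr (_ * _).
  by apply: eq_bigr => i _; rewrite !mxE.
rewrite detE derivation_sum; under [RHS]eq_bigr do rewrite detE.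
rewrite [RHS]exchange_big /=.
apply: eq_bigr => s _; rewrite -mulr_sumr.
have dsign (b : bool) x : d ((-1) ^+ b * x) = (-1) ^+ b * d x.
  by case: b; rewrite /= ?expr0 ?expr1 ?mul1r ?mulN1r ?derivationN.
rewrite dsign derivation_prod; congr (_ * _); apply: eq_bigr => c _.
by apply: eq_bigr => i _; rewrite /upd; case: eqP => // ->; rewrite mxE.
Qed.
End Derivation.
End ColumnDeterminant.

(** * Power series, vector fields and jets *)

Section CharZero.
Context (F : fieldType) (charF0 : [pchar F] =i pred0) (N : lmodType F).

Lemma natr_neq0 n : (n.+1%:R : F) != 0.
Proof. by have /pcharf0P-> := charF0. Qed.

Lemma mulrSn_eq0 (x : N) n : x *+ n.+1 = 0 -> x = 0.
Proof.
rewrite -scaler_nat => /eqP; rewrite scaler_eq0 (negbTE (natr_neq0 n)) /=.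
by move/eqP.
Qed.

Lemma eq_oppr0 (x : N) : x = - x -> x = 0.
Proof. by move=> e; apply: (@mulrSn_eq0 x 1); rewrite mulr2n {2}e subrr. Qed.
End CharZero.

Section Coordinates.
Context (F : fieldType) (k : nat).
Local Notation W := (fps F k).
Implicit Types (f g : W) (i j : 'I_k).

Definition fps_X i : W := FPS (fun m => (m == U_(i)%MM)%:R).

Lemma fps_D1 i : fps_D i (1 : W) = 0.
Proof. exact: derivation1 (fps_DM i). Qed.

Lemma fps_D_X i j : fps_D i (fps_X j) = (i == j)%:R.
Proof.
have -> : (i == j)%:R = (i == j)%:R *: (1 : W) by rewrite scaler_nat.
apply: fpsP => m /=; case: (eqVneq i j) => [->|ij].
  rewrite mul1r -[U_(j)%MM in X in _ == X]add0m eqm_add2r.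
  case: eqP => [->|_]; last by rewrite mul0rn.
  by rewrite mnmE.
rewrite mul0r; case: eqP => [/mnmP/(_ i)|_]; last by rewrite mul0rn.
by rewrite mnmDE !mnm1E eqxx [j == i]eq_sym (negbTE ij) addn1.
Qed.

(** The primitive with respect to x_i that vanishes at x_i = 0 *)
Definition fps_int i f : W :=
  FPS (fun m => if m i is n.+1 then fps_coef f (m - U_(i))%MM / n.+1%:R else 0).

(** A representation need not be continuous, so that its value at a power series
    cannot be computed from monomials; surjectivity of D_i replaces such an
    expansion. *)
Lemma fps_D_int (charF0 : [pchar F] =i pred0) i f : fps_D i (fps_int i f) = f.
Proof.
apply: fpsP => m /=; rewrite mnmDE mnm1E eqxx addn1 addmK.
rewrite -[LHS]mulr_natr.
by rewrite mulfVK // (natr_neq0 charF0).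
Qed.
End Coordinates.

Section VectorFields.
Context (F : fieldType) (k : nat).
Local Notation W := (fps F k).
Implicit Types (f g : W) (i j : 'I_k) (X Y : vf F k).

Lemma vfDE X Y i : (X + Y) i = X i + Y i.
Proof. by rewrite ffunE. Qed.
Lemma vfZE c X i : (c *: X) i = c *: X i.
Proof. by rewrite ffunE. Qed.
Lemma vf_sumE (J : Type) (r : seq J) (P : pred J) (X : J -> vf F k) i :
  (\sum_(j <- r | P j) X j) i = \sum_(j <- r | P j) X j i.
Proof.
by apply: (big_morph (fun X : vf F k => X i)) => [Y Z|]; rewrite ffunE.
Qed.

Lemma vf_derD X f g : vf_der X (f + g) = vf_der X f + vf_der X g.
Proof.
by rewrite -big_split; apply: eq_bigr => i _; rewrite raddfD mulrDr.
Qed.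

Lemma vf_derM X f g : vf_der X (f * g) = vf_der X f * g + f * vf_der X g.
Proof.
rewrite mulr_suml mulr_sumr -big_split; apply: eq_bigr => i _ /=.
by rewrite fps_DM mulrDr mulrA [f * (_ * _)]mulrCA.
Qed.

Lemma vf_derZ X c f : vf_der X (c *: f) = c *: vf_der X f.
Proof.
rewrite /vf_der scaler_sumr; apply: eq_bigr => i _.
by rewrite linearZ /= scalerAr.
Qed.

Lemma vf_der1 X : vf_der X 1 = 0.
Proof. exact: derivation1 (vf_derM X). Qed.

Lemma vf_der_linl c X Y f : vf_der (c *: X + Y) f = c *: vf_der X f + vf_der Y f.
Proof.
rewrite /vf_der scaler_sumr -big_split; apply: eq_bigr => i _ /=.
by rewrite vfDE vfZE mulrDl scalerAl.
Qed.

Lemma vf_der_X X i : vf_der X (fps_X F i) = X i.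
Proof.
rewrite /vf_der (bigD1 i) //= fps_D_X eqxx mulr1 big1 ?addr0 // => j ji.
by rewrite fps_D_X (negbTE ji) mulr0.
Qed.

Lemma vf_der_inj X Y : vf_der X =1 vf_der Y -> X = Y.
Proof. by move=> e; apply/ffunP => i; rewrite -!vf_der_X. Qed.

Lemma vf_brN X Y : vf_br X Y = - vf_br Y X.
Proof.
by apply/ffunP => i; rewrite !ffunE -sumrN; apply: eq_bigr => j _; rewrite opprB.
Qed.

Lemma vf_br_linr c X Y Z : vf_br X (c *: Y + Z) = c *: vf_br X Y + vf_br X Z.
Proof.
apply: vf_der_inj => f; rewrite vf_brE !vf_der_linl !vf_brE.
rewrite vf_derD vf_derZ opprD addrACA scalerBr; congr (_ + _).
Qed.

Lemma vf_br_linl c X Y Z : vf_br (c *: Y + Z) X = c *: vf_br Y X + vf_br Z X.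
Proof. by rewrite vf_brN vf_br_linr opprD -scalerN -!vf_brN. Qed.

Definition vf_div X : W := \sum_i fps_D i (X i).

Lemma vf_div_lin c X Y : vf_div (c *: X + Y) = c *: vf_div X + vf_div Y.
Proof.
rewrite /vf_div scaler_sumr -big_split; apply: eq_bigr => i _ /=.
by rewrite vfDE vfZE linearP.
Qed.

(** The vector field h D_i *)
Definition vf_mono (h : W) i : vf F k := [ffun j => if j == i then h else 0].

Lemma vf_der_mono h i f : vf_der (vf_mono h i) f = h * fps_D i f.
Proof.
rewrite /vf_der (bigD1 i) //= ffunE eqxx big1 ?addr0 // => j /negbTE ji.
by rewrite ffunE ji mul0r.
Qed.

Lemma vf_div_mono h i : vf_div (vf_mono h i) = fps_D i h.
Proof.
rewrite /vf_div (bigD1 i) //= ffunE eqxx big1 ?addr0 // => j /negbTE ji.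
by rewrite ffunE ji raddf0.
Qed.

Lemma vf_divB X Y : vf_div (X - Y) = vf_div X - vf_div Y.
Proof. by rewrite addrC -scaleN1r vf_div_lin scaleN1r addrC. Qed.

Lemma vf_derBl X Y f : vf_der (X - Y) f = vf_der X f - vf_der Y f.
Proof. by rewrite addrC -scaleN1r vf_der_linl scaleN1r addrC. Qed.

End VectorFields.

Section Jets.
Context (F : fieldType) (k : nat).
Local Notation W := (fps F k).
Implicit Types (f g : W) (i j : 'I_k) (X Y : vf F k).
Local Notation e_ r := (delta_mx r ord0 : 'cV[W]_k.+1).

(** The column of f in the determinant that defines the bracket *)
Definition jet : W -> 'cV[W]_k.+1 := locked (fun f =>
  \col_r (if unlift ord0 r is Some i then fps_D i f else f)).

Lemma jet0 f : jet f ord0 ord0 = f.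
Proof. by rewrite /jet -lock mxE unlift_none. Qed.

Lemma jet_lift f i : jet f (lift ord0 i) ord0 = fps_D i f.
Proof. by rewrite /jet -lock mxE liftK. Qed.

Lemma colP0 (u v : 'cV[W]_k.+1) :
  u ord0 ord0 = v ord0 ord0 ->
  (forall i, u (lift ord0 i) ord0 = v (lift ord0 i) ord0) -> u = v.
Proof.
move=> h0 h; apply/colP => r.
by case: (unliftP ord0 r) => [i ->|->].
Qed.

Lemma delta_lift i : e_ (lift ord0 i) ord0 ord0 = 0.
Proof.
by rewrite mxE eqxx andbT; case: eqP => // /eqP; rewrite (negbTE (neq_lift _ _)).
Qed.

Lemma sum_delta (c : 'I_k -> W) i :
  (\sum_j c j *: e_ (lift ord0 j)) (lift ord0 i) ord0 = c i.
Proof.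
rewrite summxE (bigD1 i) //= !mxE !eqxx mulr1 big1 ?addr0 // => j ji.
by rewrite !mxE (inj_eq lift_inj) [i == j]eq_sym (negbTE ji) mulr0.
Qed.

Lemma jetE f : jet f = f *: e_ ord0 + \sum_j fps_D j f *: e_ (lift ord0 j).
Proof.
apply: colP0 => [|i].
  rewrite jet0 mxE mxE mxE !eqxx mulr1 summxE big1 ?addr0 // => j _.
  by rewrite mxE delta_lift mulr0.
rewrite jet_lift mxE sum_delta mxE mxE eq_sym (negbTE (neq_lift _ _)).
by rewrite mulr0 add0r.
Qed.

Lemma jet1 : jet 1 = e_ ord0.
Proof.
rewrite jetE scale1r big1 ?addr0 // => j _.
by rewrite fps_D1 scale0r.
Qed.

Lemma jet_X i : jet (fps_X F i) = fps_X F i *: e_ ord0 + e_ (lift ord0 i).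
Proof.
rewrite jetE; congr (_ + _).
rewrite (bigD1 i) //= fps_D_X eqxx scale1r big1 ?addr0 // => j ji.
by rewrite fps_D_X (negbTE ji) scale0r.
Qed.

Lemma jet_lin (c : F) f g : jet (c *: f + g) = c%:A *: jet f + jet g.
Proof.
apply: colP0 => [|i]; rewrite mxE [X in _ = X + _]mxE ?jet0 ?jet_lift ?linearP /=;
  by rewrite mulr_algl.
Qed.

Lemma jetM f g : jet (f * g) = f *: jet g + g *: jet f - (f * g) *: e_ ord0.
Proof.
apply: colP0 => [|i]; rewrite !mxE ?jet0 ?jet_lift.
  by rewrite !eqxx mulr1 [g * f]mulrC; apply: esym; exact: addrK.
by rewrite mulr0 subr0 fps_DM addrC [_ * g]mulrC.
Qed.

Lemma jet_D i f : map_mx (fps_D i) (jet f) = jet (fps_D i f).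
Proof.
by apply: colP0 => [|j]; rewrite mxE ?jet0 ?jet_lift // fps_DC.
Qed.

Lemma W_brE (f : 'I_k.+1 -> W) : W_br f = detc (fun c => jet (f c)).
Proof.
congr (\det _); apply/matrixP => r c; rewrite !mxE.
by case: (unliftP ord0 r) => [i ->|->]; rewrite ?jet_lift ?jet0.
Qed.

Lemma W_br_multilinear : multilinear (@W_br F k).
Proof.
move=> a i c x y; rewrite !W_brE !(comp_upd jet) jet_lin detc_multilinear.
by rewrite [X in X + _]mulr_algl.
Qed.

Lemma W_br_alternating : alternating (@W_br F k).
Proof.
by move=> a i j ij e; rewrite W_brE; apply: (detc_alternating ij); rewrite e.
Qed.
End Jets.

(** * The inner derivations of W^n *)

Section InnerDerivation.
Context (F : fieldType) (charF0 : [pchar F] =i pred0) (p : nat).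
Local Notation W := (fps F p.+1).
Local Notation e_ r := (delta_mx r ord0 : 'cV[W]_p.+2).
Implicit Types (g h : W) (i j : 'I_p.+1) (X Y : vf F p.+1).
Implicit Types (a f : 'I_p.+1 -> W) (b : 'I_p.+2 -> W).

(** Comparing the bracket at b = 1 and at b = x_i separates the term of order
    zero of ad f from its i-th coefficient. *)
Lemma adWE f i :
  adW f i = detc (frcons (fun c => jet (f c)) (e_ (lift ord0 i))).
Proof.
have jetc g : (fun c => jet (frcons f g c)) = frcons (fun c => jet (f c)) (jet g).
  apply/funext => c; case: (unliftP ord_max c) => [c' ->|->].
    by rewrite !frcons_lift.
  by rewrite !frcons_max.
have := W_br_adW f (fps_X F i).
have := W_br_adW f 1; rewrite vf_der1 add0r mulr1 vf_der_X => <-.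
rewrite !W_brE !jetc jet1 jet_X.
rewrite (frcons_upd_max _ 0 (_ + _)) detc_multilinear -!frcons_upd_max.
by rewrite [X in _ = _ + X]mulrC [LHS]addrC => /addIr.
Qed.

Lemma adW_multilinear : multilinear (@adW F p).
Proof.
move=> a i c x y; apply/ffunP => j.
rewrite [RHS]vfDE [X in _ = X + _]vfZE; apply: etrans (adWE _ _) _.
rewrite (comp_upd (@jet F p.+1)) frcons_upd jet_lin detc_multilinear.
rewrite -!frcons_upd -!(comp_upd (@jet F p.+1)).
congr (_ + _); last exact: esym (adWE _ _).
apply: etrans (mulr_algl _ _) _; congr (_ *: _); exact: esym (adWE _ _).
Qed.

Lemma adW_alternating : alternating (@adW F p).
Proof.
move=> a i j ij e; apply/ffunP => l; rewrite adWE ffunE.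
apply: (detc_alternating (i := lift ord_max i) (j := lift ord_max j)).
  by rewrite (inj_eq lift_inj).
by rewrite !frcons_lift e.
Qed.

Lemma detc_frcons_swap n (v : 'I_n -> 'cV[W]_n.+1) c x y :
  detc (frcons (upd v c x) y) = - detc (frcons (upd v c y) x).
Proof.
rewrite !frcons_upd (frcons_upd_max _ 0 x) (frcons_upd_max _ 0 y).
apply: alternating_swap; [exact: detc_multilinear|exact: detc_alternating|].
by rewrite neq_lift.
Qed.

Lemma detc_frcons_multilinear n (w : 'cV[W]_n.+1) :
  multilinear (fun v : 'I_n -> 'cV[W]_n.+1 => detc (frcons v w)).
Proof. by move=> v c l x y; rewrite !frcons_upd detc_multilinear. Qed.

(** The coefficients of order one and zero of ad f are not independent: the
    columns D_i (jet f_c) differ from multiples of the first basis vector by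
    second derivatives, and these cancel because the determinant is
    antisymmetric in the slot c and the last one. *)
Lemma vf_div_adW f : vf_div (adW f) = - (W_br (frcons f 1) *+ p.+1).
Proof.
pose J c := jet (f c).
pose A c u i : W := detc (frcons (upd J c u) (e_ (lift ord0 i))).
have step1 i : fps_D i (adW f i) = \sum_c A c (jet (fps_D i (f c))) i.
  rewrite adWE derivation_detc; [|exact: raddfD|exact: fps_DM].
  rewrite (bigD1_ord ord_max) //= -frcons_upd_max.
  rewrite [X in X + _](_ : _ = 0) ?add0r; last first.
    rewrite frcons_max (_ : map_mx _ _ = 0); last first.
      apply/colP => r; rewrite !mxE; case: (_ && _); last exact: raddf0.
      exact: fps_D1.
    rewrite (frcons_upd_max _ 0); apply: multilinear0; exact: detc_multilinear.
  by apply: eq_bigr => c _; rewrite frcons_lift -frcons_upd jet_D.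
have step2 c g i : A c (jet g) i =
    g * A c (e_ ord0) i + \sum_j fps_D j g * A c (e_ (lift ord0 j)) i.
  have ml := detc_frcons_multilinear (e_ (lift ord0 i)).
  rewrite /A jetE (multilinearD ml) (multilinearZ ml) (multilinear_sum ml).
  by congr (_ + _); apply: eq_bigr => j _; rewrite (multilinearZ ml).
have Asym c i j : A c (e_ (lift ord0 j)) i = - A c (e_ (lift ord0 i)) j.
  exact: detc_frcons_swap.
have second c : \sum_i \sum_j fps_D j (fps_D i (f c)) * A c (e_ (lift ord0 j)) i = 0.
  apply: (eq_oppr0 charF0); rewrite -sumrN exchange_big /=.
  apply: eq_bigr => i _; rewrite -sumrN; apply: eq_bigr => j _.
  by rewrite Asym mulrN fps_DC.
have first c : \sum_i fps_D i (f c) * A c (e_ ord0) i = - W_br (frcons f 1).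
  have ml := detc_frcons_multilinear (e_ ord0).
  transitivity (- detc (frcons (upd J c (J c - f c *: e_ ord0)) (e_ ord0))).
    rewrite /J jetE addrAC subrr add0r (multilinear_sum ml) -sumrN.
    apply: eq_bigr => i _; rewrite (multilinearZ ml) /A detc_frcons_swap.
    exact: mulrN.
  rewrite (multilinearD ml) (multilinearN ml) (multilinearZ ml) upd_id.
  rewrite [X in f c *: X](_ : _ = 0) ?scaler0 ?subr0.
    congr (- _); rewrite W_brE; congr detc; apply/funext => r.
    case: (unliftP ord_max r) => [l ->|->]; first by rewrite !frcons_lift.
    by rewrite !frcons_max jet1.
  apply: (@detc_alternating _ _ _ (lift ord_max c) ord_max).
    by rewrite eq_sym neq_lift.
  by rewrite frcons_lift frcons_max upd_same.
rewrite /vf_div (eq_bigr _ (fun i _ => step1 i)) exchange_big /=.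
rewrite -mulNrn -[X in _ *+ X]card_ord -sumr_const; apply: eq_bigr => c _.
rewrite (eq_bigr _ (fun i _ => step2 c _ i)) big_split /= second addr0.
exact: first.
Qed.

(** The action of X on the densities of weight -1/(n-1), which are what the
    elements of W^n are with respect to X. *)
Definition vf_act X g : W := vf_der X g - p.+1%:R^-1 *: (vf_div X * g).

(** ad f, including its term of order zero, is determined by the vector field
    adW f. *)
Lemma W_br_act f g : W_br (frcons f g) = vf_act (adW f) g.
Proof.
rewrite /vf_act vf_div_adW mulNr scalerN opprK mulrnAl -scaler_nat scalerA.
rewrite mulVf ?scale1r ?(natr_neq0 charF0) //.
have := W_br_adW f 1; rewrite vf_der1 add0r mulr1 => ->.
exact: W_br_adW.
Qed.

Lemma vf_act_linl c X Y g : vf_act (c *: X + Y) g = c *: vf_act X g + vf_act Y g.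
Proof.
rewrite /vf_act vf_der_linl vf_div_lin mulrDl scalerDr opprD addrACA.
congr (_ + _); rewrite scalerBr; congr (_ - _).
by rewrite -scalerAl !scalerA mulrC.
Qed.

Lemma fps_D_vf_der X j g :
  fps_D j (vf_der X g) = vf_der X (fps_D j g) + \sum_i fps_D j (X i) * fps_D i g.
Proof.
rewrite /vf_der raddf_sum -big_split; apply: eq_bigr => i _ /=.
by rewrite fps_DM fps_DC addrC.
Qed.

(** X acts on a jet by deriving its entries and applying the matrix M. If u is
    the term of order zero of the action, then the trace of M is n u + div X,
    and it equals u precisely for the weight -1/(n-1). For X = adW a this is the
    Filippov identity of W^n. *)
Lemma vf_act_W_br X b :
  vf_act X (W_br b) = \sum_i W_br (upd b i (vf_act X (b i))).
Proof.
pose u : W := - (p.+1%:R^-1 *: vf_div X).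
have actE g : vf_act X g = vf_der X g + u * g.
  by rewrite /vf_act /u mulNr scalerAl.
pose M : 'M[W]_p.+2 := \matrix_(r, c)
  match unlift ord0 r, unlift ord0 c with
  | None, None => u
  | None, Some _ => 0
  | Some j, None => fps_D j u
  | Some j, Some l => fps_D j (X l) + (if j == l then u else 0)
  end.
have jet_act g : jet (vf_act X g) = map_mx (vf_der X) (jet g) + M *m jet g.
  apply: colP0 => [|j]; rewrite mxE [X in _ = X + _]mxE [X in _ = _ + X]mxE.
    rewrite !jet0 actE; congr (_ + _).
    rewrite big_ord_recl big1 ?addr0 => [|j _]; first by rewrite mxE unlift_none jet0.
    by rewrite mxE unlift_none liftK mul0r.
  rewrite big_ord_recl !jet_lift actE raddfD /= fps_DM fps_D_vf_der.
  rewrite mxE liftK unlift_none jet0.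
  rewrite [X in _ = _ + (_ + X)](eq_bigr (fun i => fps_D j (X i) * fps_D i g +
      (if j == i then u else 0) * fps_D i g)); last first.
    by move=> i _; rewrite mxE !liftK jet_lift mulrDl.
  rewrite big_split /= [X in _ = _ + (_ + (_ + X))](_ : _ = u * fps_D j g).
    by rewrite -!addrA; congr (_ + _); rewrite addrCA.
  rewrite (bigD1 j) //= eqxx big1 ?addr0 // => i; rewrite eq_sym => /negbTE->.
  by rewrite mul0r.
have trM : \tr M = u.
  rewrite /mxtrace big_ord_recl mxE unlift_none.
  rewrite (eq_bigr (fun i => fps_D i (X i) + u)); last first.
    by move=> i _; rewrite mxE liftK eqxx.
  rewrite big_split /= sumr_const card_ord -[X in _ + (X + _)]/(vf_div X).
  rewrite /u mulNrn -scaler_nat scalerA mulfV ?(natr_neq0 charF0) // scale1r.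
  by rewrite addrN addr0.
rewrite actE W_brE (derivation_detc (vf_derD X) (vf_derM X)) -[in X in _ + X]trM.
rewrite -detc_trace -big_split; apply: eq_bigr => i _ /=.
rewrite W_brE (comp_upd (@jet F p.+1)) jet_act.
by rewrite (multilinearD (@detc_multilinear _ _)).
Qed.

(** The commutator of X with ad f, computed by the Leibniz rule for the
    bracket: the two first order operators agree, and so do their vector
    fields. *)
Lemma vf_act_adW X f :
  \sum_i adW (upd f i (vf_act X (f i))) = vf_br X (adW f).
Proof.
set Z := LHS.
have actE g : vf_act Z g = \sum_i vf_act (adW (upd f i (vf_act X (f i)))) g.
  by apply: (linear_map_sum (T := vf_act^~ g)) => c Y Y'; exact: vf_act_linl.
clearbody Z.
have actZ g : vf_act Z g = vf_act X (vf_act (adW f) g) - vf_act (adW f) (vf_act X g).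
  apply: etrans (actE g) _.
  have e1 := W_br_act f g; have e2 := W_br_act f (vf_act X g).
  have e3 := vf_act_W_br X (frcons f g); rewrite e1 in e3.
  apply/esym; apply: etrans (congr2 (fun x y => x - y) e3 (esym e2)) _.
  rewrite (bigD1_ord ord_max) //= frcons_max -frcons_upd_max addrC addrK.
  apply: eq_bigr => i _; apply: etrans _ (W_br_act _ _).
  by rewrite frcons_lift frcons_upd.
pose u Y : W := - (p.+1%:R^-1 *: vf_div Y).
have uE Y g : vf_act Y g = vf_der Y g + u Y * g.
  by rewrite /vf_act /u mulNr -scalerAl.
have actK (X1 X2 : vf F p.+1) g : vf_act X1 (vf_act X2 g) =
    vf_der X1 (vf_der X2 g) + (vf_der X1 (u X2) * g + u X2 * vf_der X1 g) +
    (u X1 * vf_der X2 g + u X1 * (u X2 * g)).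
  apply: etrans (uE X1 _) _.
  by rewrite uE vf_derD vf_derM mulrDr.
have [wt wtE] : exists w, forall g, vf_act Z g = vf_der (vf_br X (adW f)) g + w * g.
  exists (vf_der X (u (adW f)) - vf_der (adW f) (u X)) => g.
  apply: etrans (actZ g) _.
  apply: etrans (congr2 (fun x y => x - y) (actK X (adW f) g) (actK (adW f) X g)) _.
  rewrite vf_brE; move: (u X) (u (adW f)) (adW f) => uX uY Y.
  move: (vf_der X uY) (vf_der Y uX) (vf_der X (vf_der Y g)) (vf_der Y (vf_der X g)).
  move: (vf_der X g) (vf_der Y g) => c1 c2 c3 c4 c5 c6.
  rewrite mulrBl !opprD; ring.
apply: vf_der_inj => g.
have := wtE g; rewrite uE; have := wtE 1; rewrite uE !vf_der1 !add0r !mulr1.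
by move=> ->; exact: addIr.
Qed.
End InnerDerivation.

(** * Expressions g df_1 .. df_p *)

Section OneForms.
Context (F : fieldType) (p : nat).
Local Notation W := (fps F p.+1).

(** Up to the factor n - 1, the value that E takes on g df_1 .. df_p. The form
    attached to (f_0, .., f_p) is the alternating sum of the forms f_i df_0 ..
    df_p, the i-th differential being omitted, so that each of its terms can be
    recovered from it by adding exact forms, which are those attached to lists
    that begin with 1. *)
Definition dform (N : lmodType F) (E : ('I_p.+1 -> W) -> N) (g : W) (H : 'I_p -> W) : N :=
  E (fcons g H) + \sum_j E (fcons 1 (upd H j (g * H j))).

Definition slotwise_der (N : lmodType F) (E : ('I_p.+1 -> W) -> N) (X : vf F p.+1) a : N :=
  \sum_i E (upd a i (vf_der X (a i))).

Definition slotwise_act (N : lmodType F) (E : ('I_p.+1 -> W) -> N) (X : vf F p.+1) a : N :=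
  \sum_i E (upd a i (vf_act X (a i))).

Context (N : lmodType F) (E : ('I_p.+1 -> W) -> N).
Hypotheses (EL : multilinear E) (EA : alternating E).
Implicit Types (g h : W) (H : 'I_p -> W) (X Y : vf F p.+1) (a b : 'I_p.+1 -> W).

Lemma dform_comp (N' : lmodType F) (E' : ('I_p.+1 -> W) -> N') (T : N' -> N) :
  (forall c x y, T (c *: x + y) = c *: T x + T y) ->
  forall g H, dform (fun a => T (E' a)) g H = T (dform E' g H).
Proof.
move=> TL g H; rewrite /dform (linear_mapD TL); congr (_ + _).
by rewrite (linear_map_sum TL).
Qed.

Lemma dform_lin (E1 E2 : ('I_p.+1 -> W) -> N) c g H :
  dform (fun a => c *: E1 a + E2 a) g H = c *: dform E1 g H + dform E2 g H.
Proof. by rewrite /dform big_split -scaler_sumr /= addrACA scalerDr. Qed.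

Lemma fcons_multilinear x :
  multilinear (fun H : 'I_p -> W => E (fcons x H)).
Proof. by move=> H i c y z; rewrite !fcons_upd EL. Qed.

Lemma fcons_alternating x :
  alternating (fun H : 'I_p -> W => E (fcons x H)).
Proof.
move=> H i j ij e; apply: (EA (i := lift ord0 i) (j := lift ord0 j)).
  by rewrite (inj_eq lift_inj).
by rewrite !fcons_lift.
Qed.

Lemma fcons_linl H c x y : E (fcons (c *: x + y) H) = c *: E (fcons x H) + E (fcons y H).
Proof. by rewrite (fcons_upd0 0 H (_ + _)) EL -!fcons_upd0. Qed.

Lemma dform_linl c g h H : dform E (c *: g + h) H = c *: dform E g H + dform E h H.
Proof.
rewrite /dform fcons_linl scalerDr addrACA scaler_sumr -big_split /=.
congr (_ + _); apply: eq_bigr => j _.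
by rewrite mulrDl -scalerAl fcons_multilinear.
Qed.

Lemma dform_multilinear g : multilinear (dform E g).
Proof.
move=> H i c x y; rewrite /dform fcons_multilinear scalerDr addrACA.
rewrite scaler_sumr -big_split /=.
congr (_ + _); apply: eq_bigr => j _.
case: (eqVneq i j) => [<-|ij].
  by rewrite !upd_same !upd_idem mulrDr -scalerAr fcons_multilinear.
by rewrite !(upd_other _ _ (j := j)) 1?eq_sym // !(updC H _ _ ij) fcons_multilinear.
Qed.

Lemma dform_alternating g : alternating (dform E g).
Proof.
move=> H i j ij e; rewrite /dform (fcons_alternating g ij) // add0r.
rewrite (bigD1 i) //= (bigD1 j) ?(eq_sym j) //= big1 ?addr0.
  rewrite -{1}(upd_id (upd H i (g * H i)) j) upd_other 1?eq_sym //.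
  rewrite (alternating_swap (fcons_multilinear 1) (fcons_alternating 1)) // -e.
  by rewrite upd_id addNr.
move=> t /andP[ti tj]; apply: (fcons_alternating 1 ij).
by rewrite !upd_other 1?eq_sym.
Qed.

(** d1 = 0 *)
Lemma dform_const g H j : dform E g (upd H j 1) = 0.
Proof.
rewrite /dform (bigD1 j) //= big1 ?addr0.
  rewrite upd_same upd_idem mulr1 fcons_upd (fcons_upd0 1).
  rewrite (fcons_upd 1 H) -[fcons 1 H](upd_id _ ord0) fcons0 upd_idem.
  by rewrite alternating_swap ?neq_lift // addNr.
move=> t tj; apply: (EA (neq_lift ord0 j)).
by rewrite fcons0 fcons_lift upd_other 1?eq_sym // upd_same.
Qed.

(** Since X 1 = 0, the summands of dform that contain 1 only produce terms that
    recombine. *)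
Lemma dform_slotwise_der X g H : dform (slotwise_der E X) g H =
  dform E (vf_der X g) H + \sum_j dform E g (upd H j (vf_der X (H j))).
Proof.
have slotwise_der_fcons x G : slotwise_der E X (fcons x G) =
    E (fcons (vf_der X x) G) + \sum_j E (fcons x (upd G j (vf_der X (G j)))).
  rewrite /slotwise_der big_ord_recl fcons0 -fcons_upd0; congr (_ + _).
  by apply: eq_bigr => j _; rewrite fcons_lift -fcons_upd.
rewrite /dform slotwise_der_fcons big_split /= -!addrA; congr (_ + _).
rewrite addrCA; congr (_ + _).
rewrite [X in _ + X]exchange_big -big_split /=; apply: eq_bigr => j _.
rewrite slotwise_der_fcons vf_der1.
rewrite [X in X + _](_ : _ = 0) ?add0r; last first.
  by rewrite (fcons_upd0 0) (multilinear0 EL).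
rewrite (bigD1 j) //= [X in _ = _ + X](bigD1 j) //= !upd_same !upd_idem addrA.
congr (_ + _).
  by rewrite vf_derM (multilinearD (fcons_multilinear 1)).
apply: eq_bigr => t tj.
by rewrite !(upd_other _ _ tj) !(upd_other _ _ (j := j)) 1?eq_sym // (updC H _ _ tj).
Qed.
End OneForms.

Section LieDerivative.
Context (F : fieldType) (p : nat) (charF0 : [pchar F] =i pred0).
Local Notation W := (fps F p.+1).
Context (N : lmodType F) (E : ('I_p.+1 -> W) -> N).
Hypotheses (EL : multilinear E) (EA : alternating E).
Implicit Types (g h : W) (H : 'I_p -> W) (X Y : vf F p.+1) (a b : 'I_p.+1 -> W).

Lemma slotwise_act_linl c X Y b :
  slotwise_act E (c *: X + Y) b = c *: slotwise_act E X b + slotwise_act E Y b.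
Proof.
rewrite /slotwise_act scaler_sumr -big_split; apply: eq_bigr => i _ /=.
by rewrite vf_act_linl EL.
Qed.

Lemma slotwise_actE (d : F) X b : vf_div X = d *: 1 ->
  slotwise_act E X b = (- d) *: E b + slotwise_der E X b.
Proof.
move=> divX; rewrite /slotwise_act.
transitivity (\sum_(i < p.+1) ((- (p.+1%:R^-1 * d)) *: E b + E (upd b i (vf_der X (b i))))).
  apply: eq_bigr => i _.
  rewrite /vf_act divX -scalerAl mul1r scalerA addrC -scaleNr EL.
  by rewrite upd_id.
rewrite big_split /=; congr (_ + _).
rewrite sumr_const card_ord -scaler_nat scalerA mulrN mulrA divff ?mul1r //.
exact: natr_neq0.
Qed.

(** A constant divergence multiplies each of the n - 1 slots by -d/(n-1); what
    remains is the Leibniz rule. *)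
Lemma dform_slotwise_act (d : F) X g H : vf_div X = d *: 1 ->
  dform (slotwise_act E X) g H =
  (- d) *: dform E g H + (dform E (vf_der X g) H +
    \sum_j dform E g (upd H j (vf_der X (H j)))).
Proof.
move=> divX; rewrite -dform_slotwise_der // -dform_lin; congr dform.
by apply/funext => b; exact: slotwise_actE.
Qed.
End LieDerivative.

(** * Normal form of vector fields *)

Section JetForms.
Context (F : fieldType) (p : nat).
Local Notation W := (fps F p.+1).
Local Notation e_ r := (delta_mx r ord0 : 'cV[W]_p.+2).
Implicit Types (f g h : W) (H : 'I_p -> W).

Variable B : ('I_p.+1 -> 'cV[W]_p.+2) -> W^o.
Hypotheses (BL : multilinear B) (BA : alternating B).
Hypothesis B_row : forall x u, B (fcons x u) =
  x ord0 ord0 * B (fcons (e_ ord0) u) +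
  \sum_j u j ord0 ord0 * B (fcons x (upd u j (e_ ord0))).

Let E (a : 'I_p.+1 -> W) : W := B (fun c => jet (a c)).
Let J H : 'I_p -> 'cV[W]_p.+2 := fun j => jet (H j).

Let J_upd H j x : J (upd H j x) = upd (J H) j (jet x).
Proof. exact: comp_upd. Qed.

Let E_fcons x H : E (fcons x H) = B (fcons (jet x) (J H)).
Proof.
congr B; apply/funext => c; case: (unliftP ord0 c) => [d ->|->].
  by rewrite !fcons_lift.
by rewrite !fcons0.
Qed.

Let fconsBL x : multilinear (fun u => B (fcons x u)).
Proof. by move=> u j c y z; rewrite !fcons_upd BL. Qed.

Let B_e0 u j : B (fcons (e_ ord0) (upd u j (e_ ord0))) = 0.
Proof.
apply: (BA (neq_lift ord0 j)).
by rewrite fcons0 fcons_lift upd_same.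
Qed.

Let B_swap u j x y : B (fcons x (upd u j y)) = - B (fcons y (upd u j x)).
Proof.
rewrite 2!fcons_upd (fcons_upd0 0 u x) (fcons_upd0 0 u y).
by apply: alternating_swap; rewrite ?neq_lift.
Qed.

(** In the expansion of the determinant along its first row, the terms with the
    entries of H cancel against those of the Leibniz rule for g * H j. *)
Lemma dform_jet g H : dform E g H = (g * E (fcons 1 H)) *+ p.+1.
Proof.
have second j : E (fcons 1 (upd H j (g * H j))) =
    g * B (fcons (e_ ord0) (J H)) - H j * B (fcons (jet g) (upd (J H) j (e_ ord0))).
  have ml := fconsBL (e_ ord0).
  rewrite E_fcons J_upd jet1 jetM (multilinearD ml) (multilinearD ml).
  rewrite (multilinearN ml).
  apply: etrans (congr2 (fun x y => x - y) (congr2 +%R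
    (multilinearZ ml (J H) j g (jet (H j))) (multilinearZ ml (J H) j (H j) (jet g)))
    (multilinearZ ml (J H) j (g * H j) (e_ ord0))) _.
  rewrite B_e0 scaler0 subr0 upd_id B_swap.
  by rewrite mulrN opprK.
rewrite /dform E_fcons B_row jet0 (eq_bigr _ (fun j _ => second j)) sumrB.
rewrite (eq_bigr (fun j => H j * B (fcons (jet g) (upd (J H) j (e_ ord0))))); last first.
  by move=> j _; rewrite jet0.
by rewrite addrACA subrr addr0 sumr_const card_ord E_fcons jet1 mulrS.
Qed.

Lemma jet_expand H (j : 'I_p) f : E (fcons 1 (upd H j f)) =
  \sum_k fps_D k f * E (fcons 1 (upd H j (fps_X F k))).
Proof.
have ml := fconsBL (e_ ord0).
rewrite E_fcons J_upd jet1 jetE ml B_e0.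
rewrite scaler0 add0r (multilinear_sum ml); apply: eq_bigr => k _.
apply: etrans (multilinearZ ml _ _ _ _) _; apply: (congr1 ( *%R _)).
by rewrite E_fcons J_upd jet1 jet_X ml B_e0 scaler0 add0r.
Qed.
End JetForms.

Section NormalForm.
Context (F : fieldType) (charF0 : [pchar F] =i pred0) (p : nat).
Local Notation W := (fps F p.+1).
Local Notation e_ r := (delta_mx r ord0 : 'cV[W]_p.+2).
Implicit Types (f g h : W) (i k l : 'I_p.+1) (X Y : vf F p.+1).
Implicit Types (H : 'I_p -> W).

(** The i-th component of adW, as a function of the columns of jets *)
Let B i (u : 'I_p.+1 -> 'cV[W]_p.+2) : W^o := detc (frcons u (e_ (lift ord0 i))).

Let B_alternating i : alternating (B i).
Proof.
move=> u c d cd e; apply: (detc_alternating (i := lift ord_max c) (j := lift ord_max d)).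
  by rewrite (inj_eq lift_inj).
by rewrite !frcons_lift.
Qed.

Let B_row i x (u : 'I_p -> 'cV[W]_p.+2) : B i (fcons x u) =
  x ord0 ord0 * B i (fcons (e_ ord0) u) +
  \sum_j u j ord0 ord0 * B i (fcons x (upd u j (e_ ord0))).
Proof.
rewrite /B (detc_row ord0) (bigD1_ord ord_max) //= frcons_max delta_lift mul0r.
rewrite add0r big_ord_recl frcons_lift fcons0 -frcons_upd -fcons_upd0.
apply: (congr1 (+%R _)); apply: eq_bigr => j _.
by rewrite frcons_lift fcons_lift -frcons_upd -fcons_upd.
Qed.

Let adW_B a i : adW a i = B i (fun c => jet (a c)).
Proof. exact: adWE. Qed.

Lemma dform_adWE g H i :
  dform (@adW F p) g H i = (g * adW (fcons 1 H) i) *+ p.+1.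
Proof.
have TL c X Y : (c *: X + Y : vf F p.+1) i = c *: X i + Y i by rewrite !ffunE.
apply: etrans (esym (dform_comp (@adW F p) TL g H)) _.
have -> : (fun a => adW a i) = (fun a => B i (fun c => jet (a c))).
  by apply/funext => a; exact: adW_B.
apply: etrans (dform_jet (@detc_frcons_multilinear _ _ _ _) (@B_alternating i) (B_row i) _ _) _.
by apply: (congr1 (fun x => (g * x) *+ p.+1)); apply/esym; exact: adW_B.
Qed.

Lemma dform_adW_expand g H (j : 'I_p) f :
  dform (@adW F p) g (upd H j f) =
  \sum_k dform (@adW F p) (g * fps_D k f) (upd H j (fps_X F k)).
Proof.
apply/ffunP => i; apply: etrans (dform_adWE _ _ _) _.
apply: etrans _ (esym (vf_sumE _ _ _ _)).
apply: etrans _ (eq_bigr _ (fun k _ => esym (dform_adWE _ _ _))).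
rewrite sumrMnl; apply: (congr1 (fun x => x *+ p.+1)).
transitivity (g * \sum_k fps_D k f * adW (fcons 1 (upd H j (fps_X F k))) i).
  apply: (congr1 ( *%R g)); apply: etrans (adW_B _ _) _; apply: etrans.
    exact: (jet_expand (@detc_frcons_multilinear _ _ _ _) (@B_alternating i)).
  by apply: eq_bigr => k _; apply: (congr1 ( *%R _)); apply/esym; exact: adW_B.
by rewrite mulr_sumr; apply: eq_bigr => k _; rewrite mulrA.
Qed.

Definition coords l : 'I_p -> W := fun t => fps_X F (lift l t).

Lemma adW_coords l i :
  adW (fcons 1 (coords l)) i = if i == l then (-1) ^+ (p.+2 - l) else 0.
Proof.
rewrite ffunE /Delta; case: eqVneq => [->|il].
  rewrite -det_tr det_trig.
    rewrite big1 ?mulr1 // => c _; rewrite !mxE.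
    case: (unliftP ord0 c) => [t ->|->]; last by rewrite fcons0.
    by rewrite fcons_lift fps_D_X eqxx.
  apply/is_trig_mxP => c r cr; rewrite !mxE.
  case: (unliftP ord0 r) => [t Er|Er]; last by rewrite Er ltn0 in cr.
  case: (unliftP ord0 c) => [s Ec|->]; last by rewrite fcons0 fps_D1.
  rewrite Ec fcons_lift fps_D_X (inj_eq lift_inj).
  by rewrite Er Ec in cr *; case: eqP cr => // ->; rewrite ltnn.
case: (unliftP i l) il => [t El _|->]; last by rewrite eqxx.
rewrite (expand_det_row _ (lift ord0 t)) big1 ?mulr0 // => c _.
rewrite !mxE liftK -El.
case: (unliftP ord0 c) => [s ->|->]; last by rewrite fcons0 fps_D1 mul0r.
by rewrite fcons_lift fps_D_X (negbTE (neq_lift _ _)) mul0r.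
Qed.

(** The l-th coefficient of a vector field, normalized so as to be the one that
    goes with the l-th list of coordinates in the normal form *)
Definition vf_coef X l : W := ((-1) ^+ (p.+2 - l) * p.+1%:R^-1) *: X l.

Lemma vf_coef_lin c X Y l : vf_coef (c *: X + Y) l = c *: vf_coef X l + vf_coef Y l.
Proof. by rewrite /vf_coef vfDE vfZE scalerDr !scalerA [c * _]mulrC. Qed.

Let sign_natK n : p.+1%:R * (-1) ^+ n * ((-1) ^+ n * p.+1%:R^-1) = 1 :> F.
Proof.
by rewrite mulrA -(mulrA p.+1%:R) -exprMn mulrNN mulr1 expr1n mulr1 divff ?natr_neq0.
Qed.

Let scale_sign n (x : W) : (-1) ^+ n *: x = (-1) ^+ n * x.
Proof. by rewrite -signr_odd -[in RHS]signr_odd scaler_sign mulr_sign. Qed.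

Let vf_coefK X l : ((-1) ^+ (p.+2 - l) *: vf_coef X l) *+ p.+1 = X l.
Proof. by rewrite -scaler_nat !scalerA sign_natK scale1r. Qed.

(** h D_l is, up to sign, the form h dx_0 .. dx_p with dx_l omitted. *)
Lemma vf_normal_form X : X = \sum_l dform (@adW F p) (vf_coef X l) (coords l).
Proof.
apply/ffunP => i; rewrite vf_sumE.
rewrite (eq_bigr (fun l => if l == i then X i else 0)).
  by rewrite -big_mkcond big_pred1_eq.
move=> l _; rewrite dform_adWE adW_coords eq_sym; case: eqP => [->|_]; last first.
  by rewrite mulr0 mul0rn.
by rewrite [_ * (-1) ^+ _]mulrC -scale_sign vf_coefK.
Qed.

Lemma vf_coef_dform_coords h l i :
  vf_coef (dform (@adW F p) h (coords l)) i = if i == l then h else 0.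
Proof.
rewrite /vf_coef dform_adWE adW_coords; case: eqP => [->|_]; last first.
  by rewrite mulr0 mul0rn scaler0.
rewrite [_ * (-1) ^+ _]mulrC -scale_sign -scaler_nat !scalerA.
by rewrite [X in X *: _](_ : _ = 1) ?scale1r // -mulrA mulrC sign_natK.
Qed.
End NormalForm.

(** * Antisymmetric forms that vanish on the normal form *)

Section Core.
Context (F : fieldType) (charF0 : [pchar F] =i pred0) (p : nat).
Local Notation W := (fps F p.+1).
Context (N : lmodType F) (E : ('I_p.+1 -> W) -> N).
Hypotheses (EL : multilinear E) (EA : alternating E).
Hypothesis E_anti : forall a b, slotwise_act E (adW a) b = - slotwise_act E (adW b) a.
Implicit Types (f g h : W) (H : 'I_p -> W) (X Y : vf F p.+1).
Implicit Types (a b : 'I_p.+1 -> W) (i k l : 'I_p.+1).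

(** Write X through the normal form as a combination of adW a. Antisymmetry
    then exchanges X and adW b, and the result depends on b only through
    adW b. *)
Lemma slotwise_act_factor X : exists L : vf F p.+1 -> N,
  (forall c Y Z, L (c *: Y + Z) = c *: L Y + L Z) /\
  forall b, slotwise_act E X b = L (adW b).
Proof.
exists (fun Y => - \sum_l dform (slotwise_act E Y) (vf_coef X l) (coords F l)).
have actL b c (Y Z : vf F p.+1) :
    slotwise_act E (c *: Y + Z) b = c *: slotwise_act E Y b + slotwise_act E Z b.
  exact: slotwise_act_linl.
split=> [c Y Z|b].
  rewrite scalerN -opprD scaler_sumr -big_split; congr (- _).
  apply: eq_bigr => l _ /=; rewrite -dform_lin; congr dform.
  by apply/funext => b; exact: actL.
rewrite {1}(vf_normal_form charF0 X) -sumrN.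
transitivity (\sum_l slotwise_act E (dform (@adW F p) (vf_coef X l) (coords F l)) b).
  exact: (linear_map_sum (actL b)).
apply: eq_bigr => l _; rewrite -(dform_comp _ (actL b)) -scaleN1r.
rewrite -[RHS]addr0; have -> : (0 : N) = dform (fun=> 0) (vf_coef X l) (coords F l).
  by rewrite /dform big1 ?addr0.
rewrite -dform_lin; congr dform; apply/funext => a.
by rewrite scaleN1r addr0; exact: E_anti.
Qed.

Lemma dform_slotwise_act_factor X : exists L : vf F p.+1 -> N,
  (forall c Y Z, L (c *: Y + Z) = c *: L Y + L Z) /\
  forall g H, dform (slotwise_act E X) g H = L (dform (@adW F p) g H).
Proof.
have [L [LL LE]] := slotwise_act_factor X; exists L; split=> // g H.
rewrite -(dform_comp _ LL); congr dform.
by apply/funext => b; exact: LE.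
Qed.

Section OneSlot.
Variables (l : 'I_p.+1) (j : 'I_p).
Local Notation l' := (lift l j).

(** The form g df, all the other slots being filled with coordinates, and its
    deviation from the sum of the g (D_k f) dx_k *)
Let Q g f := dform E g (upd (coords F l) j f).
Let theta g f := Q g f - \sum_k Q (g * fps_D k f) (fps_X F k).

Let QDr g f h : Q g (f + h) = Q g f + Q g h.
Proof. by rewrite /Q (multilinearD (dform_multilinear EL g)). Qed.

Let QDl g f h : Q (g + h) f = Q g f + Q h f.
Proof. by rewrite -[g in LHS]scale1r /Q (dform_linl EL) scale1r. Qed.

Let thetaDr g f h : theta g (f + h) = theta g f + theta g h.
Proof.
rewrite /theta QDr [RHS]addrACA -opprD -big_split; congr (_ - _).
by apply: eq_bigr => k _ /=; rewrite raddfD mulrDr QDl.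
Qed.

Let coords_killed i t : (i == l) || (i == l') -> t != j ->
  fps_D i (coords F l t) = 0.
Proof.
move=> il tj; rewrite /coords fps_D_X; case: (eqVneq i (lift l t)) il => [->|//].
by rewrite eq_sym (negbTE (neq_lift _ _)) /= (inj_eq lift_inj) (negbTE tj).
Qed.

(** Applying slotwise_act (q D_i) to the relation df = sum of (D_k f) dx_k among
    vector fields. For affine q the result is again an instance of theta, up
    to the divergence d. *)
Let theta_invariant i q (d : F) g f :
    (i == l) || (i == l') -> fps_D i q = d *: 1 ->
    (forall h, \sum_k Q (h * fps_D k q) (fps_X F k) = Q h q) ->
  theta (q * fps_D i g) f + theta g (q * fps_D i f) = d *: theta g f.
Proof.
move=> il Dq affine_q; pose X := vf_mono q i.
have divX : vf_div X = d *: 1 by rewrite vf_div_mono.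
pose P g f := dform (slotwise_act E X) g (upd (coords F l) j f).
have PE g1 f1 : P g1 f1 =
    (- d) *: Q g1 f1 + (Q (q * fps_D i g1) f1 + Q g1 (q * fps_D i f1)).
  rewrite /P (dform_slotwise_act charF0 EL _ _ divX) vf_der_mono; congr (_ + (_ + _)).
  rewrite (bigD1 j) //= upd_same upd_idem vf_der_mono big1 ?addr0 // => t tj.
  rewrite vf_der_mono upd_other // coords_killed // mulr0.
  exact: (multilinear0 (dform_multilinear EL g1)).
have Pexp : P g f = \sum_k P (g * fps_D k f) (fps_X F k).
  have [L [LL LE]] := dform_slotwise_act_factor X.
  rewrite /P LE dform_adW_expand; under [RHS]eq_bigr do rewrite LE.
  exact: (linear_map_sum LL).
have QX h : \sum_k Q (h * fps_D k f) (q * fps_D i (fps_X F k)) = Q (h * fps_D i f) q.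
  rewrite (bigD1 i) //= fps_D_X eqxx mulr1 big1 ?addr0 // => k ki.
  rewrite fps_D_X eq_sym (negbTE ki) mulr0.
  exact: (multilinear0 (dform_multilinear EL _)).
have thetaX : theta g (q * fps_D i f) = Q g (q * fps_D i f) -
    (Q (g * fps_D i f) q + \sum_k Q (g * (q * fps_D i (fps_D k f))) (fps_X F k)).
  rewrite /theta -affine_q -big_split; congr (_ - _); apply: eq_bigr => k _ /=.
  by rewrite -QDl fps_DM mulrDr fps_DC [fps_D k q * _]mulrC !mulrA.
have thetaXl : theta (q * fps_D i g) f = Q (q * fps_D i g) f -
    \sum_k Q (q * fps_D i g * fps_D k f) (fps_X F k) by [].
have sumP : \sum_k P (g * fps_D k f) (fps_X F k) =
    (- d) *: (\sum_k Q (g * fps_D k f) (fps_X F k)) +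
    ((\sum_k Q (q * fps_D i g * fps_D k f) (fps_X F k) +
      \sum_k Q (g * (q * fps_D i (fps_D k f))) (fps_X F k)) + Q (g * fps_D i f) q).
  rewrite -QX scaler_sumr -!big_split; apply: eq_bigr => k _ /=.
  rewrite PE -QDl; congr (_ + (Q _ _ + _)).
  by rewrite fps_DM mulrDr !mulrA [q * g]mulrC.
move: Pexp; rewrite PE sumP thetaXl thetaX /theta scalerBr !scaleNr.
set A := Q g f; set B := \sum_k Q (g * fps_D k f) _.
set C := Q (q * _) f; set D := \sum_k Q (q * _ * _) _.
set G := \sum_k Q (g * (q * _)) _; set U := Q g (q * _); set V := Q _ q => e.
clearbody A B C D G U V.
rewrite addrACA -opprD [V + _]addrC [D + _]addrA.
have -> : C + U = d *: A - d *: B + (D + G + V).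
  by rewrite -addrA -e addrA addrN add0r.
by rewrite addrK.
Qed.

Let Q0l f : Q 0 f = 0.
Proof. exact: (linear_map0 (fun c g h => dform_linl EL c g h _)). Qed.

Let affine1 h : \sum_k Q (h * fps_D k (1 : W)) (fps_X F k) = Q h 1.
Proof.
rewrite big1 => [|k _]; last by rewrite fps_D1 mulr0 Q0l.
by rewrite /Q (dform_const EL EA).
Qed.

Let affineX r h : \sum_k Q (h * fps_D k (fps_X F r)) (fps_X F k) = Q h (fps_X F r).
Proof.
rewrite (bigD1 r) //= fps_D_X eqxx mulr1 big1 ?addr0 // => k kr.
by rewrite fps_D_X (negbTE kr) mulr0 Q0l.
Qed.

(** Invariance under D_j and x_i D_j makes multiplication by x_i self-adjoint,
    because D_j is onto; invariance under D_i then says that x_i D_i acts as -1,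
    whereas it must act as its divergence 1. *)
Let theta0 g f : theta g f = 0.
Proof.
have ll : (l == l) || (l == l') by rewrite eqxx.
have l'l : (l' == l) || (l' == l') by rewrite eqxx orbT.
have invD i g1 f1 : (i == l) || (i == l') ->
    theta (fps_D i g1) f1 = - theta g1 (fps_D i f1).
  move=> il; apply/eqP; rewrite -addr_eq0; apply/eqP.
  have := @theta_invariant i 1 0 g1 f1 il.
  rewrite !mul1r !scale0r; apply; first exact: fps_D1.
  exact: affine1.
have swap h f1 : theta (fps_X F l * h) f1 = theta h (fps_X F l * f1).
  rewrite -(fps_D_int charF0 l' h); set k := fps_int _ _.
  have := @theta_invariant l' (fps_X F l) 0 k f1 l'l.
  rewrite scale0r fps_D_X [l' == l]eq_sym (negbTE (neq_lift _ _)) scale0r.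
  move=> /(_ erefl (affineX l)) /eqP; rewrite addr_eq0 => /eqP ->.
  rewrite invD // fps_DM fps_D_X [l' == l]eq_sym (negbTE (neq_lift _ _)).
  by rewrite mul0r add0r.
have := @theta_invariant l (fps_X F l) 1 g f ll.
rewrite !scale1r fps_D_X eqxx => /(_ erefl (affineX l)).
rewrite swap invD // fps_DM fps_D_X eqxx mul1r thetaDr opprD addrNK => e.
by apply: (eq_oppr0 charF0); rewrite e.
Qed.

Hypothesis E_coords : forall h i, dform E h (coords F i) = 0.

Lemma dform_slot0 h f : dform E h (upd (coords F l) j f) = 0.
Proof.
have := theta0 h f; rewrite /theta => /eqP; rewrite subr_eq0 => /eqP e.
rewrite [LHS]e big1 // => k _; rewrite /Q.
have -> : upd (coords F l) j (fps_X F k) =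
    (fun t => fps_X F (upd (lift l) j k t)) by rewrite comp_upd.
apply: (alternating_reindex0 (dform_multilinear EL _) (dform_alternating EL EA _)).
by move=> i; exact: E_coords.
Qed.
End OneSlot.

Hypothesis E_coords : forall h l, dform E h (coords F l) = 0.

(** By factorization through adW b it suffices to let X act on the normal form,
    which changes one coordinate at a time. *)
Lemma slotwise_act_div0 X b : vf_div X = 0 -> slotwise_act E X b = 0.
Proof.
move=> divX; have [L [LL LE]] := slotwise_act_factor X.
have [L' [LL' LE']] := dform_slotwise_act_factor X.
rewrite LE (vf_normal_form charF0 (adW b)).
have -> c : L (\sum_l dform (@adW F p) (c l) (coords F l)) =
    \sum_l dform (slotwise_act E X) (c l) (coords F l).
  rewrite (linear_map_sum LL).
  apply: eq_bigr => l _; rewrite -(dform_comp _ LL); congr dform.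
  by apply/funext => a; rewrite LE.
apply: big1 => l _.
rewrite (dform_slotwise_act charF0 EL (d := 0)) ?scale0r // oppr0 scale0r E_coords !add0r.
by apply: big1 => j _; exact: dform_slot0.
Qed.

Lemma dform_div0 X g H : vf_div X = 0 ->
  dform E (vf_der X g) H + \sum_j dform E g (upd H j (vf_der X (H j))) = 0.
Proof.
move=> divX; have := @dform_slotwise_act _ _ charF0 _ _ EL 0 X g H.
rewrite scale0r oppr0 scale0r add0r => /(_ divX) <-.
have -> : slotwise_act E X = fun=> 0 by apply/funext => b; exact: slotwise_act_div0.
by rewrite /dform big1 ?addr0.
Qed.

(** The coordinates in the slots are replaced by arbitrary functions one by one:
    h is the image of a coordinate under a field without divergence, the
    divergence of h D_i being compensated along the first coordinate. *)
Lemma dform_vanish g H : dform E g H = 0.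
Proof.
suff ind (k : nat) : forall g H,
    (forall t : 'I_p, (k <= t)%N -> H t = fps_X F (lift ord0 t)) -> dform E g H = 0.
  by apply: (ind p) => t; rewrite leqNgt ltn_ord.
elim: k => [|k IH] {}g {}H Hk.
  by rewrite (_ : H = coords F ord0) ?E_coords //; apply/funext => t; exact: Hk.
have [kp|pk] := ltnP k p; last first.
  by apply: IH => t kt; have := ltn_ord t; rewrite ltnNge (leq_trans pk kt).
pose t0 := Ordinal kp; pose i := lift ord0 t0.
pose X := vf_mono (H t0) i - vf_mono (fps_int ord0 (fps_D i (H t0))) ord0.
have divX : vf_div X = 0 by rewrite vf_divB !vf_div_mono fps_D_int // subrr.
have derX t : vf_der X (fps_X F (lift ord0 t)) = if t == t0 then H t0 else 0.
  rewrite vf_derBl !vf_der_mono !fps_D_X (negbTE (neq_lift _ _)) mulr0 subr0.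
  rewrite (inj_eq lift_inj) [t0 == t]eq_sym.
  by case: eqP => _; rewrite ?mulr1 ?mulr0.
pose H' := upd H t0 (fps_X F i).
have H'k (t : 'I_p) : (k <= t)%N -> H' t = fps_X F (lift ord0 t).
  rewrite /H' /upd; case: eqP => [->//|/eqP tt0]; rewrite leq_eqVlt => /orP[/eqP e|].
    by rewrite (_ : t = t0) ?eqxx // in tt0; apply/val_inj.
  exact: Hk.
have := dform_div0 g H' divX; rewrite IH // add0r (bigD1 t0) //= big1 ?addr0.
  by rewrite H'k // derX eqxx /H' upd_idem upd_id.
move=> t tt0; have [kt|tk] := leqP k t.
  rewrite H'k // derX (negbTE tt0).
  exact: (multilinear0 (dform_multilinear EL g)).
apply: IH => s ks; rewrite upd_other ?H'k //.
by apply: contraTneq tk => <-; rewrite -leqNgt.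
Qed.

(** The list (1, H) is the exact form 1 dH, and any other list differs from a
    form g dH by exact ones. *)
Lemma form_vanish a : E a = 0.
Proof.
have E1 H : E (fcons 1 H) = 0.
  apply: (mulrSn_eq0 charF0 (n := p)); have := dform_vanish 1 H.
  rewrite /dform; under eq_bigr do rewrite mul1r upd_id.
  by rewrite sumr_const card_ord mulrS.
have := dform_vanish (a ord0) (fun j => a (lift ord0 j)).
by rewrite /dform fcons_eta big1 ?addr0 // => j _; exact: E1.
Qed.
End Core.

(** * Representations as actions of lists of n - 1 elements *)

Lemma frcons_fcons (T : Type) (k : nat) (x y : T) (u : 'I_k -> T) :
  frcons (fcons x u) y = fcons x (frcons u y).
Proof.
apply/funext => j; case: (unliftP ord_max j) => [j' ->|->]; last first.
  rewrite frcons_max (_ : ord_max = lift ord0 ord_max) ?fcons_lift ?frcons_max //.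
  exact/val_inj.
rewrite frcons_lift; case: (unliftP ord0 j') => [t ->|->].
  rewrite fcons_lift (_ : lift ord_max _ = lift ord0 (lift ord_max t)).
    by rewrite fcons_lift frcons_lift.
  by apply/val_inj; rewrite /= /bump /= !add1n ltnS addnS.
rewrite fcons0 (_ : lift ord_max ord0 = ord0) ?fcons0 //.
exact/val_inj.
Qed.

Lemma frcons_skip (T : Type) (k : nat) (a : 'I_k.+1 -> T) x l :
  (fun j => frcons a x (lift (lift ord_max l) j)) =
  frcons (fun j => a (lift l j)) x.
Proof.
apply/funext => j; case: (unliftP ord_max j) => [t ->|->].
  rewrite frcons_lift (_ : lift _ _ = lift ord_max (lift l t)) ?frcons_lift //.
  apply/val_inj; rewrite /= /bump /=.
  rewrite (leqNgt k.+1 l) ltn_ord /= add0n.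
  rewrite (leqNgt k t) ltn_ord /= add0n.
  have := ltn_ord t; case: (leqP l t) => h tk; rewrite ?add1n ?add0n.
    by rewrite ltnNge tk.
  by rewrite leqNgt (ltn_trans tk) //= add0n.
rewrite frcons_max (_ : lift _ _ = ord_max) ?frcons_max //.
apply/val_inj; rewrite /= /bump /= (leqNgt k.+1 l) ltn_ord /= add0n.
by rewrite -ltnS ltn_ord.
Qed.

Lemma exchange_lift (N : zmodType) (n : nat) (G : 'I_n.+1 -> 'I_n.+1 -> N) :
  \sum_(i < n.+1) \sum_(t < n) G i (lift i t) =
  \sum_(j < n.+1) \sum_(t < n) G (lift j t) j.
Proof.
have rest (H : 'I_n.+1 -> N) (i : 'I_n.+1) : \sum_(t < n) H (lift i t) = \sum_j H j - H i.
  by rewrite [X in _ = X - _](bigD1_ord i) //= addrAC addrN add0r.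
under eq_bigr do rewrite (rest (G _)).
under [RHS]eq_bigr => j _ do rewrite (rest (G^~ j)).
by rewrite !sumrB exchange_big.
Qed.

Section Actions.
Context (F : fieldType) (p : nat) (V : lmodType F) (br : ('I_p.+2 -> V) -> V).
Context (M : lmodType F).
Implicit Types (rho : ('I_p.+1 -> V) -> M -> M) (m : M).
Implicit Types (B : ('I_p.+2 -> V * M) -> (V * M)%type).
Implicit Types (z : 'I_p.+2 -> (V * M)%type).

(** What remains of the axioms for (a, m) |-> [a_1, .., a_(n-1), m]. The last two
    are the Filippov identity with the element of M in the inner bracket, and
    with the element of M among the outer arguments. *)
Record nlie_action rho : Prop := NLieAction {
  action_multilinear : forall m, multilinear (rho^~ m);
  action_alternating : forall m, alternating (rho^~ m);
  action_linear : forall a (c : F) m m', rho a (c *: m + m') = c *: rho a m + rho a m';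
  action_commutator : forall a b m, rho a (rho b m) =
    rho b (rho a m) + \sum_t rho (upd b t (br (frcons a (b t)))) m;
  action_bracket : forall b u m, rho (fcons (br b) u) m =
    \sum_(i < p.+2) (-1) ^+ (i + p.+1) *:
      rho (fun j : 'I_p.+1 => b (lift i j)) (rho (fcons (b i) u) m) }.

(** The only bracket by which a representation can extend br and rho: an
    argument in M is moved from slot i to the last one. *)
Definition action_ext rho z : (V * M)%type :=
  (br (fun i => (z i).1),
   \sum_(i < p.+2) (-1) ^+ (i + p.+1) *:
      rho (fun j : 'I_p.+1 => (z (lift i j)).1) (z i).2).

Section FromRep.
Variable B : ('I_p.+2 -> V * M) -> (V * M)%type.
Hypothesis repB : nlie_rep br B.

Let BL : multilinear B. Proof. by case: repB => -[]. Qed.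
Let BA : alternating B. Proof. by case: repB => -[]. Qed.
Let BF a b : B (frcons a (B b)) = \sum_(i < p.+2) B (upd b i (B (frcons a (b i)))).
Proof. by case: repB => -[_ _ h] _ _ _; exact: h. Qed.
Let BV a : B (fun i => (a i, 0)) = (br a, 0).
Proof. by case: repB => _ h _ _; exact: h. Qed.
Let BM z i : (z i).1 = 0 -> (B z).1 = 0.
Proof. by case: repB => _ _ h _; exact: h. Qed.
Let BMM z i j : i != j -> (z i).1 = 0 -> (z j).1 = 0 -> B z = 0.
Proof. by case: repB => _ _ _ h; exact: h. Qed.

Let split_slot z j :
  B z = B (upd z j ((z j).1, 0)) + B (upd z j (0, (z j).2)).
Proof.
rewrite -(multilinearD BL) -[z in LHS](upd_id z j); congr (B (upd _ _ _)).
by case: (z j) => v m; congr (_, _); rewrite /= ?addr0 ?add0r.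
Qed.

Let strip (s : seq 'I_p.+2) z : 'I_p.+2 -> (V * M)%type :=
  fun i => if i \in s then ((z i).1, 0) else z i.

Let strip_cons j s z : strip (j :: s) z = upd (strip s z) j ((z j).1, 0).
Proof. by apply/funext => i; rewrite /strip /upd inE; case: eqP => // ->. Qed.

Let strip1 s z i : (strip s z i).1 = (z i).1.
Proof. by rewrite /strip; case: ifP. Qed.

Let strip_ideal z i s : (z i).1 = 0 -> i \notin s -> B z = B (strip s z).
Proof.
move=> zi0; elim: s => [|j s IH] // /norP[ij js].
rewrite IH // (split_slot _ j) strip_cons strip1 -[RHS]addr0; congr (_ + _).
apply: (BMM ij); last by rewrite upd_same.
by rewrite upd_other // strip1.
Qed.

Let zV z : 'I_p.+2 -> (V * M)%type := fun i => ((z i).1, 0).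

Let strip_upd z j s x : B (upd (strip s z) j (0, x)) = B (upd (zV z) j (0, x)).
Proof.
have e y : (forall i, (y i).1 = (z i).1) ->
    B (upd y j (0, x)) = B (upd (zV z) j (0, x)).
  move=> yz; rewrite (@strip_ideal _ j [seq i <- enum 'I_p.+2 | i != j]).
  - congr B; apply/funext => i; rewrite /strip mem_filter mem_enum andbT /upd.
    by case: eqP => //= _; rewrite yz.
  - by rewrite upd_same.
  - by rewrite mem_filter eqxx.
by apply: e => i; exact: strip1.
Qed.

Let expand z : B z = B (zV z) + \sum_j B (upd (zV z) j (0, (z j).2)).
Proof.
have ind s : uniq s ->
    B z = B (strip s z) + \sum_(j <- s) B (upd (zV z) j (0, (z j).2)).
  elim: s => [|j s IH] /=; first by rewrite big_nil addr0.
  case/andP => js us; rewrite IH // (split_slot _ j) big_cons strip_cons -!addrA.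
  have -> : strip s z j = z j by rewrite /strip (negbTE js).
  by rewrite strip_upd.
rewrite (ind (index_enum 'I_p.+2)) ?index_enum_uniq //; congr (B _ + _).
by apply/funext => i; rewrite /strip mem_index_enum.
Qed.

Let act_slot (a : 'I_p.+2 -> V) j x : B (upd (fun i => (a i, 0)) j (0, x)) =
  (0, (-1) ^+ (j + p.+1) *: nlie_act B (fun t => a (lift j t)) x).
Proof.
have := alternating_frcons BL BA (fun i => (a i, 0)) j (0, x).
move=> /(congr1 ( *:%R ((-1) ^+ (j + p.+1)))).
rewrite scalerA -exprMn mulrNN mulr1 expr1n scale1r => <-.
rewrite [LHS]surjective_pairing; congr (_, _).
by rewrite /= (@BM _ ord_max) ?scaler0 // frcons_max.
Qed.

(** Expand every argument into its components in V and M: only the terms with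
    at most one component in M survive. *)
Lemma nlie_repE z : B z = action_ext (nlie_act B) z.
Proof.
rewrite expand BV [RHS]surjective_pairing /=.
have -> : \sum_(j < p.+2) B (upd (zV z) j (0, (z j).2)) =
    \sum_(j < p.+2) (0, (-1) ^+ (j + p.+1) *:
      nlie_act B (fun t : 'I_p.+1 => (z (lift j t)).1) (z j).2).
  by apply: eq_bigr => j _; exact: act_slot.
rewrite [LHS]surjective_pairing !raddfD /= !raddf_sum /= big1 // addr0.
by rewrite add0r.
Qed.

Let frcons_pair0 k (a : 'I_k -> V) v :
  frcons (fun i => (a i, 0 : M)) (v, 0) = fun i => (frcons a v i, 0).
Proof.
apply/funext => i; case: (unliftP ord_max i) => [t ->|->].
  by rewrite !frcons_lift.
by rewrite !frcons_max.
Qed.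

Let act_pair (a : 'I_p.+1 -> V) m :
  B (frcons (fun i => (a i, 0)) (0, m)) = (0, nlie_act B a m).
Proof.
rewrite [LHS]surjective_pairing; congr (_, _).
by rewrite (@BM _ ord_max) // frcons_max.
Qed.

Let upd_pair0 k (a : 'I_k -> V) i v :
  (fun j => (upd a i v j, 0 : M)) = upd (fun j => (a j, 0)) i (v, 0).
Proof. exact: (comp_upd (fun v => (v, 0))). Qed.

Let pair0_lin c (x y : V) : (c *: x + y, 0 : M) = c *: (x, 0) + (y, 0).
Proof. by congr (_, _); rewrite /= scaler0 addr0. Qed.

Let act_multilinear m : multilinear ((nlie_act B)^~ m).
Proof.
by move=> a i c x y; rewrite /nlie_act !upd_pair0 !frcons_upd pair0_lin BL.
Qed.

Let act_alternating m : alternating ((nlie_act B)^~ m).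
Proof.
move=> a i j ij e.
rewrite /nlie_act (BA (i := lift ord_max i) (j := lift ord_max j)) //.
  by rewrite (inj_eq lift_inj).
by rewrite !frcons_lift e.
Qed.

Let act_linear a (c : F) m m' :
  nlie_act B a (c *: m + m') = c *: nlie_act B a m + nlie_act B a m'.
Proof.
have pm : (0, c *: m + m') = c *: (0 : V, m) + (0, m').
  by congr (_, _); rewrite /= scaler0 addr0.
rewrite /nlie_act pm (frcons_upd_max _ 0 (_ + _)) BL.
by rewrite -!frcons_upd_max.
Qed.

Lemma nlie_rep_action : nlie_action (nlie_act B).
Proof.
split=> // [a b m|b u m].
  have := BF (fun i => (a i, 0)) (frcons (fun i => (b i, 0)) (0, m)).
  rewrite act_pair act_pair (bigD1_ord ord_max) //= frcons_max act_pair.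
  rewrite -frcons_upd_max act_pair => /(congr1 snd) /= ->; congr (_ + _).
  rewrite raddf_sum; apply: eq_bigr => t _ /=.
  by rewrite frcons_lift frcons_pair0 BV -frcons_upd -upd_pair0.
(* m is in the first slot of the outer list *)
have shift v : B (frcons (fcons (0, m) (fun i => (u i, 0))) (v, 0)) =
    (0, - nlie_act B (fcons v u) m).
  set z := frcons _ _.
  have z0 : z ord0 = (0, m) by rewrite /z frcons_fcons fcons0.
  have zS t : z (lift ord0 t) = (frcons u v t, 0).
    by rewrite /z frcons_fcons fcons_lift frcons_pair0.
  rewrite [LHS]surjective_pairing (@BM _ ord0) ?z0 //; congr (_, _).
  rewrite nlie_repE /= big_ord_recl z0 big1 => [|i _]; last first.
    rewrite zS /nlie_act (frcons_upd_max _ 0) (multilinear0 BL).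
    by rewrite scaler0.
  have -> : (fun j => (z (lift ord0 j)).1) = frcons u v.
    by apply/funext => j; rewrite zS.
  rewrite addr0 add0n.
  rewrite (alternating_fcons_frcons (@act_multilinear m) (@act_alternating m)).
  by rewrite exprS mulN1r scaleNr.
have := BF (fcons (0, m) (fun i => (u i, 0))) (fun i => (b i, 0)).
rewrite BV shift => /(congr1 snd) /= /eqP; rewrite eqr_oppLR => /eqP ->.
rewrite raddf_sum -sumrN; apply: eq_bigr => i _ /=.
rewrite shift act_slot /= -scalerN; congr (_ *: _).
have := @act_linear (fun t => b (lift i t)) (-1) (nlie_act B (fcons (b i) u) m) 0.
rewrite addr0 !scaleN1r => ->.
have -> : nlie_act B (fun t => b (lift i t)) 0 = 0.
  by rewrite /nlie_act (frcons_upd_max _ 0) (multilinear0 BL).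
by rewrite addr0 opprK.
Qed.
End FromRep.

Section FromAction.
Variable rho : ('I_p.+1 -> V) -> M -> M.
Hypotheses (brP : is_nlie br) (rhoP : nlie_action rho).
Implicit Types (b : 'I_p.+2 -> V).

Let brL : multilinear br. Proof. by case: brP. Qed.
Let brA : alternating br. Proof. by case: brP. Qed.
Let rhoL := action_multilinear rhoP.
Let rhoA := action_alternating rhoP.

Let rhoD a m m' : rho a (m + m') = rho a m + rho a m'.
Proof. by rewrite -[m in LHS]scale1r (action_linear rhoP) scale1r. Qed.

Let rho0 a : rho a 0 = 0.
Proof. by apply: (@addrI _ (rho a 0)); rewrite -rhoD !addr0. Qed.

Let rhoZ a c m : rho a (c *: m) = c *: rho a m.
Proof. by rewrite -[c *: m]addr0 (action_linear rhoP) rho0 addr0. Qed.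

Let rho_sum a (J : finType) (G : J -> M) : rho a (\sum_j G j) = \sum_j rho a (G j).
Proof. exact: (big_morph (rho a) (rhoD a) (rho0 a)). Qed.

Local Notation sg i := ((-1) ^+ (i + p.+1)).
Local Notation ext2 z :=
  (\sum_(i < p.+2) sg i *: rho (fun j : 'I_p.+1 => (z (lift i j)).1) (z i).2).

(** Omitting either of two equal entries gives lists that differ by a cycle. *)
Let omit_swap b (i j : 'I_p.+2) m : i != j -> b i = b j ->
  sg i *: rho (fun t => b (lift i t)) m + sg j *: rho (fun t => b (lift j t)) m = 0.
Proof.
move=> ij e.
have ne t : j != tperm i j (lift i t).
  rewrite -[X in X != _](tpermL i j) (inj_eq perm_inj) neq_lift //.
pose psi t := sval (unlift_some (ne t)).
have psiE t : tperm i j (lift i t) = lift j (psi t).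
  by rewrite /psi; case: (unlift_some (ne t)).
have inj : injective psi.
  move=> s t /(congr1 (lift j)); rewrite -!psiE.
  by move/perm_inj/lift_inj.
pose s := perm inj.
have es : lift_perm i j s = tperm i j.
  apply/permP => r; case: (unliftP i r) => [t ->|->].
    by rewrite lift_perm_lift permE psiE.
  by rewrite lift_perm_id tpermL.
have := odd_lift_perm i j s; rewrite es odd_tperm ij => os.
have -> : (fun t => b (lift i t)) = (fun t => (fun r => b (lift j r)) (s t)).
  apply/funext => t; rewrite permE -psiE.
  by case: tpermP => [->|->|].
rewrite (alternating_perm (@rhoL m) (@rhoA m) (fun r => b (lift j r))) scalerA -scalerDl.
rewrite !exprD mulrAC -mulrDl -[(-1) ^+ i]signr_odd -[(-1) ^+ j]signr_odd.
rewrite -signr_addb; have -> : odd i (+) s = ~~ odd j.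
  by move: os; case: (odd i); case: (odd j); case: (odd_perm s).
by case: (odd j); rewrite /= ?expr0 ?expr1 ?addNr ?addrN mul0r scale0r.
Qed.

Let split2 z (i : 'I_p.+2) : ext2 z = sg i *: rho (fun j => (z (lift i j)).1) (z i).2 +
  \sum_(t < p.+1) sg (lift i t) *:
    rho (fun j => (z (lift (lift i t) j)).1) (z (lift i t)).2.
Proof. exact: bigD1_ord. Qed.

Let ext_linear : multilinear (action_ext rho).
Proof.
move=> z i c x y.
have fst_upd (w : V * M) : (fun r => (upd z i w r).1) = upd (fun r => (z r).1) i w.1.
  exact: (comp_upd fst).
rewrite /action_ext !fst_upd brL [RHS]surjective_pairing; congr (_, _).
rewrite /= scaler_sumr -big_split; apply: eq_bigr => r _ /=.
have skip (w : V * M) : (fun j => (upd z i w (lift r j)).1) =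
    (fun j => upd (fun r => (z r).1) i w.1 (lift r j)).
  by apply/funext => j; rewrite -fst_upd.
rewrite !skip; case: (unliftP r i) => [t ->|->].
  rewrite !upd_lift_lift !(upd_other _ _ (neq_lift _ _)).
  by rewrite rhoL scalerDr !scalerA [sg r * c]mulrC.
by rewrite !upd_lift !upd_same (action_linear rhoP) scalerDr !scalerA [sg r * c]mulrC.
Qed.

Let ext_alternating : alternating (action_ext rho).
Proof.
move=> z i j ij e; rewrite /action_ext (brA ij) ?e //; congr (_, _).
rewrite (bigD1 i) //= (bigD1 j) ?(eq_sym j) //= big1 ?addr0.
  by rewrite -e (@omit_swap (fun r => (z r).1)) ?e.
move=> r /andP[ri rj].
case: (unliftP r i) ri => [s Ei _|->]; last by rewrite eqxx.
case: (unliftP r j) rj => [t Ej _|->]; last by rewrite eqxx.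
rewrite (@rhoA _ _ s t) ?scaler0 -?Ei -?Ej ?e //.
by apply: contraNneq ij => st; rewrite Ei Ej st.
Qed.

Let sg_max : sg (@ord_max p.+1) = 1 :> F.
Proof. by rewrite /= -signr_odd oddD addbb. Qed.

Let ext_frcons (a : 'I_p.+1 -> V * M) (v : V) (m : M) :
  ext2 (frcons a (v, m)) = rho (fun i => (a i).1) m + \sum_(l < p.+1)
    sg l *: ((-1) ^+ p *: rho (fcons v (fun t => (a (lift l t)).1)) (a l).2).
Proof.
have skip l : (fun j => (frcons a (v, m) (lift (lift ord_max l) j)).1) =
    frcons (fun t => (a (lift l t)).1) v.
  rewrite -(frcons_skip (fun i => (a i).1)); apply/funext => j.
  by rewrite /frcons; case: (unlift _ _).
rewrite (split2 _ ord_max) sg_max scale1r frcons_max; congr (_ + _).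
  by congr rho; apply/funext => t; rewrite frcons_lift.
apply: eq_bigr => l _; rewrite skip frcons_lift lift_max; congr (_ *: _).
rewrite (alternating_fcons_frcons (@rhoL _) (@rhoA _)) scalerA -exprMn.
by rewrite mulrNN mulr1 expr1n scale1r.
Qed.

Let fst_frcons (a : 'I_p.+1 -> V * M) x :
  (fun i => (frcons a x i).1) = frcons (fun i => (a i).1) x.1.
Proof. by apply/funext => i; rewrite /frcons; case: (unlift _ _). Qed.

Let ext_filippov : filippov (action_ext rho).
Proof.
move=> a b.
pose al := fun i => (a i).1; pose be := fun i => (b i).1.
pose ga i := br (frcons al (be i)).
pose u l := fun t => al (lift l t).
pose eta i := rho al (b i).2 + \sum_(l < p.+1)
  sg l *: ((-1) ^+ p *: rho (fcons (be i) (u l)) (a l).2).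
have inner i : action_ext rho (frcons a (b i)) = (ga i, eta i).
  rewrite /action_ext fst_frcons; congr (_, _).
  by rewrite [b i]surjective_pairing ext_frcons.
have fst_upd i (w : V * M) : (fun r => (upd b i w r).1) = upd be i w.1.
  exact: (comp_upd fst).
have outer i : action_ext rho (upd b i (ga i, eta i)) =
    (br (upd be i (ga i)), sg i *: rho (fun j => be (lift i j)) (eta i) +
      \sum_(t < p.+1) sg (lift i t) *:
        rho (fun j => upd be i (ga i) (lift (lift i t) j)) (b (lift i t)).2).
  rewrite /action_ext fst_upd; congr (_, _); rewrite (split2 _ i) upd_same.
  congr (_ *: rho _ _ + _).
    by apply/funext => j; rewrite upd_other // eq_sym neq_lift.
  apply: eq_bigr => t _; rewrite upd_other; last by rewrite eq_sym neq_lift.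
  congr (_ *: rho _ _); apply/funext => j.
  exact: (congr1 (fun f => f _) (fst_upd i (ga i, eta i))).
have -> : \sum_(i < p.+2) action_ext rho
    [eta b with i |-> action_ext rho (frcons a (b i))] =
    \sum_(i < p.+2) action_ext rho (upd b i (ga i, eta i)).
  by apply: eq_bigr => i _; rewrite -inner.
rewrite [LHS]surjective_pairing [RHS]surjective_pairing !raddf_sum /=.
congr (_, _).
  rewrite fst_frcons /=; case: brP => _ _ -> /=.
  by apply: eq_bigr => i _; rewrite fst_upd.
rewrite [action_ext rho b]surjective_pairing ext_frcons /=.
apply/esym; apply: etrans (eq_bigr _ (fun i _ => congr1 snd (outer i))) _.
apply/esym; rewrite /=.
rewrite big_split /= /eta.
under [X in _ = X + _]eq_bigr do rewrite rhoD scalerDr.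
rewrite big_split /=.
rewrite [RHS]addrAC; congr (_ + _).
  pose G (i j : 'I_p.+2) := sg j *: rho (fun s => upd be i (ga i) (lift j s)) (b j).2.
  rewrite [X in _ = _ + X](@exchange_lift _ _ G) rho_sum -big_split.
  apply: eq_bigr => j _ /=.
  rewrite rhoZ (action_commutator rhoP) scalerDr scaler_sumr; congr (_ + _).
  by apply: eq_bigr => t _; rewrite /G upd_lift_lift.
under [RHS]eq_bigr do rewrite rho_sum scaler_sumr.
rewrite [RHS]exchange_big; apply: eq_bigr => l _ /=.
rewrite (action_bracket rhoP) !scaler_sumr; apply: eq_bigr => i _.
by rewrite !rhoZ !scalerA mulrC mulrA.
Qed.

Lemma action_ext_rep : nlie_rep br (action_ext rho).
Proof.
split=> [|a|z i zi0|z i j ij zi0 zj0].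
- by split; [exact: ext_linear|exact: ext_alternating|exact: ext_filippov].
- by congr (_, _); rewrite big1 // => i _; rewrite rho0 scaler0.
- rewrite /= -[fun _ => _](upd_id _ i) zi0; exact: multilinear0.
rewrite [LHS]surjective_pairing; congr (_, _).
  rewrite /= -[fun _ => _](upd_id _ i) zi0; exact: multilinear0.
have zero r s : r != s -> (z s).1 = 0 ->
    rho (fun t => (z (lift r t)).1) (z r).2 = 0.
  case: (unliftP r s) => [t -> _ zs|->]; last by rewrite eqxx.
  by rewrite -[fun _ => _](upd_id _ t) zs (multilinear0 (@rhoL _)).
rewrite /= big1 // => r _; case: (eqVneq r i) => [->|ri].
  by rewrite (zero i j) // scaler0.
by rewrite (zero r i) // scaler0.
Qed.

Lemma nlie_act_ext : nlie_act (action_ext rho) = rho.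
Proof.
apply/funext => a; apply/funext => m.
rewrite /nlie_act /= ext_frcons big1 ?addr0 // => l _.
by rewrite rho0 !scaler0.
Qed.
End FromAction.
End Actions.

(** * The universal property of the enveloping algebra *)

Section WordAction.
Context (F : fieldType) (L : choiceType) (M : lmodType F) (tau : L -> M -> M).
Hypothesis tau_lin : forall x (c : F) m m', tau x (c *: m + m') = c *: tau x m + tau x m'.
Local Notation A := {malg F[{fmonom L}]}.
Implicit Types (z : A) (m : M).

Definition word_act (k : {fmonom L}) m : M := foldr tau m k.

Definition malg_act z m : M := \sum_(k <- monalg.msupp z) monalg.mcoeff k z *: word_act k m.

Lemma word_act_lin k (c : F) m m' :
  word_act k (c *: m + m') = c *: word_act k m + word_act k m'.
Proof. by rewrite /word_act; elim: (k : seq L) => //= x s ->. Qed.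

Lemma malg_actEw (d : {fset {fmonom L}}) z m : (monalg.msupp z `<=` d)%fset ->
  malg_act z m = \sum_(k <- d) monalg.mcoeff k z *: word_act k m.
Proof.
move=> le; rewrite /malg_act (big_fset_incl _ le) // => k _ kz.
by rewrite mcoeff_outdom // scale0r.
Qed.

Lemma malg_act_lin (c : F) z z' m :
  malg_act (c *: z + z') m = c *: malg_act z m + malg_act z' m.
Proof.
pose d := (monalg.msupp z `|` monalg.msupp z' `|` monalg.msupp (c *: z + z'))%fset.
have dz : (monalg.msupp z `<=` d)%fset by rewrite /d -fsetUA fsubsetUl.
have dz' : (monalg.msupp z' `<=` d)%fset by rewrite /d fsetUAC fsubsetUr.
have dzz' : (monalg.msupp (c *: z + z') `<=` d)%fset by rewrite /d fsubsetUr.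
rewrite (malg_actEw _ dz) (malg_actEw _ dz') (malg_actEw _ dzz').
rewrite scaler_sumr -big_split; apply: eq_bigr => k _ /=.
by rewrite monalg.mcoeffD monalg.mcoeffZ scalerDl scalerA.
Qed.

Lemma malg_actU (c : F) k m : malg_act (mkmalgU k c) m = c *: word_act k m.
Proof.
have le : (monalg.msupp (mkmalgU k c) `<=` [fset k])%fset by exact: monalg.msuppU_le.
by rewrite (malg_actEw _ le) big_seq_fset1 mcoeffUU.
Qed.

Lemma malg_act_sum (J : Type) (r : seq J) (P : pred J) (G : J -> A) m :
  malg_act (\sum_(j <- r | P j) G j) m = \sum_(j <- r | P j) malg_act (G j) m.
Proof.
by apply: (linear_map_sum (T := malg_act^~ m)) => c z z'; exact: malg_act_lin.
Qed.

Lemma malg_act_linr z (c : F) m m' :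
  malg_act z (c *: m + m') = c *: malg_act z m + malg_act z m'.
Proof.
rewrite /malg_act scaler_sumr -big_split; apply: eq_bigr => k _ /=.
by rewrite word_act_lin scalerDr !scalerA mulrC.
Qed.

Lemma malg_act0r z : malg_act z 0 = 0.
Proof.
exact: (linear_map0 (malg_act_linr z)).
Qed.

Lemma malg_actM z z' m : malg_act (z * z') m = malg_act z (malg_act z' m).
Proof.
rewrite malgME malg_act_sum [RHS]/malg_act; apply: eq_bigr => k _.
rewrite malg_act_sum [malg_act z' m]/malg_act.
rewrite (linear_map_sum (word_act_lin k)) scaler_sumr; apply: eq_bigr => k' _.
rewrite malg_actU -scalerA; congr (_ *: _).
rewrite /word_act fmM foldr_cat -/(word_act _ _).
rewrite -/(word_act k _) -[_ *: word_act k' m]addr0 word_act_lin.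
by rewrite (linear_map0 (word_act_lin k)) addr0.
Qed.

Lemma malg_act_gen x m : malg_act (mkmalgU (fmu x) 1) m = tau x m.
Proof. by rewrite malg_actU scale1r /word_act fmU. Qed.

Lemma malg_act1 m : malg_act 1 m = m.
Proof. by rewrite -[1]/(mkmalgU _ 1) malg_actU scale1r /word_act fm1. Qed.
End WordAction.

Section UniversalProperty.
Context (F : fieldType) (L : lmodType F) (br : L -> L -> L).
Local Notation U := (uea br).
Local Notation pi := (\pi_(uea br))%qT.

Lemma uea_genM (x y : L) : uea_gen br x * uea_gen br y = pi (free_gen x * free_gen y).
Proof. exact: uea_piM. Qed.

Lemma uea_gen_lin (c : F) (x y : L) :
  uea_gen br (c *: x + y) = c *: uea_gen br x + uea_gen br y.
Proof.
apply: etrans (_ : pi (c *: free_gen x + free_gen y) = _).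
  by apply: uea_pi; apply: ideal_gen_sub; left; exists c, x, y.
by apply/esym; apply: etrans (congr1 (@uea_add _ _ br ^~ _) (uea_piZ br _ _)) (uea_piD br _ _).
Qed.

Lemma uea_gen_br (x y : L) : uea_gen br (br x y) =
  uea_gen br x * uea_gen br y - uea_gen br y * uea_gen br x.
Proof.
rewrite !uea_genM; apply/esym.
apply: etrans (congr1 (@uea_add _ _ br _) (uea_piN br _)) _.
apply: etrans (uea_piD br _ _) _.
by apply: uea_pi; apply: ideal_gen_sub; right; exists x, y.
Qed.

Lemma uea_gen_ind (P : U -> Prop) :
  P 1 -> (forall (c : F) u v, P u -> P v -> P (c *: u + v)) ->
  (forall u v, P u -> P v -> P (u * v)) -> (forall x, P (uea_gen br x)) ->
  forall u, P u.
Proof.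
move=> P1 Plin PM Pgen; elim/uea_ind => z.
have P0 : P 0 by rewrite -(addNr 1) -scaleN1r; exact: Plin.
have PD u v : P u -> P v -> P (u + v).
  by rewrite -[u in P (u + v)]scale1r; exact: Plin.
have PZ (c : F) u : P u -> P (c *: u).
  by move=> Pu; rewrite -[c *: u]addr0; exact: Plin.
have Pword (s : seq L) : P (pi (mkmalgU (FMonom s) 1)).
  elim: s => [|x s IH].
    by rewrite (_ : mkmalgU _ _ = 1) //; congr (mkmalgU _ _); exact/val_inj/esym/fm1.
  suff -> : pi (mkmalgU (FMonom (x :: s)) 1) = uea_gen br x * pi (mkmalgU (FMonom s) 1).
    exact: PM.
  apply/esym; apply: etrans (uea_piM br _ _) _; congr pi.
  rewrite malgM_def fgmulUU mulr1; congr (mkmalgU _ _).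
  by apply/val_inj; rewrite /= fmM fmU.
rewrite [z]monalgE.
apply: (big_ind (fun z => P (pi z))) => //.
  by move=> y y' Py Py'; rewrite -uea_piD; exact: PD.
move=> k _; have -> : mkmalgU k (monalg.mcoeff k z) =
    monalg.mcoeff k z *: (mkmalgU k 1 : free_alg L).
  by apply/malgP => k'; rewrite monalg.mcoeffZ !monalg.mcoeffU mulrnAr mulr1.
by rewrite -uea_piZ; apply: PZ; case: k => s; exact: Pword.
Qed.

Section Lift.
Context (M : lmodType F) (tau : L -> M -> M).
Hypotheses (tau_linr : forall x (c : F) m m',
    tau x (c *: m + m') = c *: tau x m + tau x m')
  (tau_linl : forall (c : F) x y m, tau (c *: x + y) m = c *: tau x m + tau y m)
  (tau_br : forall x y m, tau (br x y) m = tau x (tau y m) - tau y (tau x m)).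

(** The action through a representative in the free algebra; it does not depend
    on the representative because the kernel of an action is an ideal. *)
Definition uea_lift (u : U) (m : M) : M := malg_act tau (generic_quotient.repr u) m.

Let actB (z z' : free_alg L) m :
  malg_act tau (z - z') m = malg_act tau z m - malg_act tau z' m.
Proof. by have := malg_act_lin tau (-1) z' z m; rewrite !scaleN1r addrC [RHS]addrC. Qed.

Let act0 m : malg_act tau (0 : free_alg L) m = 0.
Proof. by rewrite -(subrr (0 : free_alg L)) actB subrr. Qed.

Let act_gen x m : malg_act tau (free_gen x) m = tau x m.
Proof. exact: malg_act_gen. Qed.

Let act_genM x y m : malg_act tau (free_gen x * free_gen y) m = tau x (tau y m).
Proof. by apply: etrans (malg_actM tau_linr _ _ _) _; rewrite !act_gen. Qed.

Let act_ideal (z : free_alg L) m : ideal_gen (@uea_rel F L br) z -> malg_act tau z m = 0.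
Proof.
move=> /(_ (fun z => forall m, malg_act tau z m = 0)); apply.
  split=> [|x y hx hy m'|a x hx m'|a x hx m'].
  - exact: act0.
  - by rewrite -[x]scale1r malg_act_lin scale1r hx hy addr0.
  - by rewrite malg_actM // hx malg_act0r.
  - by rewrite malg_actM // hx.
move=> y [[c [x [x' ->]]]|[x [x' ->]]] m'.
  by rewrite actB malg_act_lin !act_gen tau_linl subrr.
apply: etrans (actB _ _ _) _.
apply: etrans (congr2 (fun a b => a - b) (actB _ _ _) (act_gen _ _)) _.
apply: etrans (congr1 (fun a => a - _)
  (congr2 (fun a b => a - b) (act_genM _ _ _) (act_genM _ _ _))) _.
by rewrite tau_br subrr.
Qed.

Let lift_pi (z : free_alg L) m : uea_lift (pi z) m = malg_act tau z m.
Proof.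
apply/eqP; rewrite -subr_eq0 -actB; apply/eqP; apply: act_ideal.
exact: uea_repr.
Qed.

Lemma uea_lift_gen x m : uea_lift (uea_gen br x) m = tau x m.
Proof. by rewrite lift_pi malg_act_gen. Qed.

Lemma uea_lift_rep : alg_rep uea_lift.
Proof.
split=> [u c m m'|c u v m|m|u v m].
- exact: malg_act_linr.
- elim/uea_ind: u => x; elim/uea_ind: v => y.
  have e : c *: pi x + pi y = pi (c *: x + y).
    by apply: etrans (congr1 (@uea_add _ _ br ^~ _) (uea_piZ br _ _)) (uea_piD br _ _).
  by rewrite e !lift_pi; exact: malg_act_lin.
- by apply: etrans (lift_pi 1 m) _; exact: malg_act1.
elim/uea_ind: u => x; elim/uea_ind: v => y.
have e : pi x * pi y = pi (x * y) by exact: uea_piM.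
by rewrite e !lift_pi; exact: malg_actM.
Qed.
End Lift.

Section RepFacts.
Context (M : lmodType F) (s : U -> M -> M).
Hypothesis sP : alg_rep s.

Lemma alg_rep_gen_stable (N : M -> Prop) : subspace N ->
  (forall x m, N m -> N (s (uea_gen br x) m)) -> forall u m, N m -> N (s u m).
Proof.
case: sP => _ slin s1 sM [N0 Nlin] Ngen.
apply: uea_gen_ind => [m|c u v hu hv m Nm|u v hu hv m Nm|//].
- by rewrite s1.
- by rewrite slin; apply: Nlin; [exact: hu|exact: hv].
- by rewrite sM; apply: hu; exact: hv.
Qed.

Lemma alg_rep_gen_intertwine (M' : lmodType F) (s' : U -> M' -> M')
    (phi : {linear M -> M'}) : alg_rep s' ->
  (forall x m, s' (uea_gen br x) (phi m) = phi (s (uea_gen br x) m)) ->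
  forall u m, s' u (phi m) = phi (s u m).
Proof.
case: sP => _ slin s1 sM [_ slin' s1' sM'] gen.
apply: uea_gen_ind => [m|c u v hu hv m|u v hu hv m|//].
- by rewrite s1 s1'.
- by rewrite slin slin' hu hv linearP.
- by rewrite sM sM' hv hu.
Qed.
End RepFacts.
End UniversalProperty.

(** * The action of n - 1 elements of W^n as an action of vector fields *)

Section LieAction.
Context (F : fieldType) (charF0 : [pchar F] =i pred0) (p : nat).
Local Notation W := (fps F p.+1).
Implicit Types (a b f : 'I_p.+1 -> W) (X Y Z : vf F p.+1).

Lemma W_br_nlie : is_nlie (@W_br F p.+1).
Proof.
split; [exact: W_br_multilinear|exact: W_br_alternating|] => a b.
apply: etrans (W_br_act charF0 _ _) _; apply: etrans (vf_act_W_br charF0 _ _) _.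
apply: eq_bigr => i _; apply: (congr1 (fun x => W_br (upd b i x))).
apply/esym; exact: W_br_act.
Qed.

(** By the normal form, Inder(W^n) is the whole of W_(n-1). *)
Lemma vf_adW_ind (P : vf F p.+1 -> Prop) :
  (forall c X Y, P X -> P Y -> P (c *: X + Y)) -> (forall a, P (adW a)) ->
  forall X, P X.
Proof.
move=> Plin Pad X.
have P0 : P 0.
  by rewrite -(addNr (adW (fun=> 0))) -scaleN1r; apply: Plin.
have PD Y Z : P Y -> P Z -> P (Y + Z).
  by rewrite -[Y in P (Y + Z)]scale1r; exact: Plin.
rewrite (vf_normal_form charF0 X); apply: (big_ind P) => // l _.
by apply: (PD) => //; apply: (big_ind P).
Qed.

Context (M : lmodType F) (rho : ('I_p.+1 -> W) -> M -> M).
Hypothesis rhoP : nlie_action (@W_br F p.+1) rho.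

Definition lie_action X m : M :=
  \sum_l dform (rho^~ m) (vf_coef X l) (coords F l).

Let rhoL := action_multilinear rhoP.
Let rhoA := action_alternating rhoP.

Lemma lie_action_linl c X Y m :
  lie_action (c *: X + Y) m = c *: lie_action X m + lie_action Y m.
Proof.
rewrite /lie_action scaler_sumr -big_split; apply: eq_bigr => l _ /=.
by rewrite vf_coef_lin dform_linl.
Qed.

Lemma lie_action_linr X c m m' :
  lie_action X (c *: m + m') = c *: lie_action X m + lie_action X m'.
Proof.
rewrite /lie_action scaler_sumr -big_split; apply: eq_bigr => l _ /=.
rewrite -dform_lin; congr dform; apply/funext => a.
exact: (action_linear rhoP).
Qed.

Lemma rho_commutator a b m :
  slotwise_act (rho^~ m) (adW a) b = rho a (rho b m) - rho b (rho a m).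
Proof.
rewrite (action_commutator rhoP) addrC addKr; apply: eq_bigr => i _.
apply: (congr1 (fun x => rho (upd b i x) m)); apply/esym; exact: W_br_act.
Qed.

(** The difference of the two sides is a form that vanishes on the normal form,
    and it is antisymmetric because both the commutator of the operators rho a
    and the bracket of vector fields are. *)
Lemma lie_action_adW f m : lie_action (adW f) m = rho f m.
Proof.
pose T X := lie_action X m.
have TL c X Y : T (c *: X + Y) = c *: T X + T Y by exact: lie_action_linl.
have T0 : T 0 = 0.
  exact: linear_map0.
pose E f := -1 *: T (adW f) + rho f m.
have EL : multilinear E.
  have lin (c : F) (x y u v : M) : -1 *: (c *: x + y) + (c *: u + v) =
      c *: (-1 *: x + u) + (-1 *: y + v).
    by rewrite !scalerDr addrACA !scalerA mulrC.
  by move=> a i c x y; rewrite /E adW_multilinear TL rhoL; exact: lin.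
have EA : alternating E.
  by move=> a i j ij e; rewrite /E (adW_alternating ij e) T0 scaler0 add0r (rhoA m ij).
have actE X b : slotwise_act E X b = -1 *: T (vf_br X (adW b)) + slotwise_act (rho^~ m) X b.
  rewrite /slotwise_act big_split -scaler_sumr; congr (_ *: _ + _).
  rewrite -(vf_act_adW charF0); exact/esym/linear_map_sum.
have anti a b : slotwise_act E (adW a) b = - slotwise_act E (adW b) a.
  have brN : T (vf_br (adW a) (adW b)) = - T (vf_br (adW b) (adW a)).
    have TN Z : T (- Z) = - T Z.
      by rewrite -[- Z]scaleN1r -[_ *: Z]addr0 TL T0 addr0 scaleN1r.
    by apply: etrans (TN _); apply: congr1; exact: vf_brN.
  apply: etrans (actE _ _) _; apply: etrans _ (esym (congr1 -%R (actE _ _))).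
  apply: etrans (congr2 (fun x y => -1 *: x + y) brN (rho_commutator a b m)) _.
  apply: etrans _ (esym (congr1 (fun y => - (-1 *: _ + y)) (rho_commutator b a m))).
  by rewrite scalerN opprD opprB.
have Ecoords h l : dform E h (coords F l) = 0.
  rewrite dform_lin (dform_comp _ TL) /T /lie_action scaleN1r.
  apply/eqP; rewrite addrC subr_eq0; apply/eqP.
  rewrite (bigD1 l) //= vf_coef_dform_coords // eqxx big1 ?addr0 // => i il.
  rewrite vf_coef_dform_coords // (negbTE il).
  have := dform_linl (@rhoL m) (-1) 0 0 (coords F i).
  by rewrite scaler0 addr0 scaleN1r addNr.
have := form_vanish charF0 EL EA anti Ecoords f.
by rewrite /E scaleN1r addrC => /eqP; rewrite subr_eq0 => /eqP.
Qed.

Lemma lie_action_br X Y m :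
  lie_action (vf_br X Y) m = lie_action X (lie_action Y m) - lie_action Y (lie_action X m).
Proof.
move: X Y m; apply: vf_adW_ind => [c X1 X2 h1 h2 Y m|a].
  rewrite vf_br_linl !lie_action_linl h1 h2 lie_action_linr.
  by rewrite opprD addrACA scalerBr.
apply: vf_adW_ind => [c Y1 Y2 h1 h2 m|b m].
  rewrite vf_br_linr !lie_action_linl h1 h2 lie_action_linr.
  by rewrite opprD addrACA scalerBr.
rewrite -(vf_act_adW charF0).
have -> : lie_action (\sum_i adW (upd b i (vf_act (adW a) (b i)))) m =
    \sum_i lie_action (adW (upd b i (vf_act (adW a) (b i)))) m.
  by apply: (linear_map_sum (T := lie_action^~ m)) => c Y Z; exact: lie_action_linl.
apply: etrans (eq_bigr _ (fun i _ => lie_action_adW _ _)) _.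
apply: etrans (rho_commutator a b m) _.
have twice a1 a2 : lie_action (adW a1) (lie_action (adW a2) m) = rho a1 (rho a2 m).
  exact: etrans (lie_action_adW a1 _) (congr1 (rho a1) (lie_action_adW a2 m)).
by apply/esym; exact: (congr2 (fun x y => x - y) (twice a b) (twice b a)).
Qed.
End LieAction.

(** * The correspondence *)

Section Dictionary.
Context (F : fieldType) (charF0 : [pchar F] =i pred0) (p : nat).
Local Notation W := (fps F p.+1).
Local Notation U := (uea (@vf_br F p.+1)).
Local Notation gen := (uea_gen (@vf_br F p.+1)).
Implicit Types (a f : 'I_p.+1 -> W) (X Y : vf F p.+1).

Section OneModule.
Context (M : lmodType F) (s : U -> M -> M).
Hypothesis sP : alg_rep s.

Let s_linr u (c : F) m m' : s u (c *: m + m') = c *: s u m + s u m'.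
Proof. by case: sP. Qed.
Let s_linl (c : F) u v m : s (c *: u + v) m = c *: s u m + s v m.
Proof. by case: sP => _ + _ _; apply. Qed.
Let sM u v m : s (u * v) m = s u (s v m).
Proof. by case: sP => _ _ _; apply. Qed.
Let s0l m : s 0 m = 0.
Proof.
by apply: (linear_map0 (T := s^~ m)) => c u v; exact: s_linl.
Qed.
Let s0r u : s u 0 = 0.
Proof.
exact: (linear_map0 (s_linr u)).
Qed.
Let sB u v m : s (u - v) m = s u m - s v m.
Proof. by have := s_linl (-1) v u m; rewrite !scaleN1r addrC [RHS]addrC. Qed.
Let sD u v m : s (u + v) m = s u m + s v m.
Proof. by rewrite -[u in LHS]scale1r s_linl scale1r. Qed.
Let s_sum (J : finType) (G : J -> U) m : s (\sum_j G j) m = \sum_j s (G j) m.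
Proof. by apply: (linear_map_sum (T := s^~ m)) => c u v; exact: s_linl. Qed.
Let sZ (c : F) u m : s (c *: u) m = c *: s u m.
Proof. by rewrite -[c *: u]addr0 s_linl s0l addr0. Qed.

Let s_gen_linl (c : F) X Y m : s (gen (c *: X + Y)) m = c *: s (gen X) m + s (gen Y) m.
Proof. by rewrite uea_gen_lin s_linl. Qed.

Let s_gen_br X Y m :
  s (gen (vf_br X Y)) m = s (gen X) (s (gen Y) m) - s (gen Y) (s (gen X) m).
Proof.
apply: etrans (congr1 (s^~ m) (uea_gen_br _ _ _)) _; apply: etrans (sB _ _ _) _.
exact: (congr2 (fun x y => x - y) (sM _ _ _) (sM _ _ _)).
Qed.

Let sign_uea k (u : U) : (-1) ^+ k * u = (-1) ^+ k *: u.
Proof. by rewrite -signr_odd -[in RHS]signr_odd scaler_sign mulr_sign. Qed.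

(** The vanishing of the left-hand side is the axiom action_bracket. *)
Lemma alg_rep_xW (b : 'I_p.+2 -> W) (u : 'I_p -> W) m :
  s (xW b u) m = s (ad_uea (fcons (W_br b) u)) m -
    \sum_(i < p.+2) (-1) ^+ (i + p.+1) *:
      s (ad_uea (fun j => b (lift i j))) (s (ad_uea (fcons (b i) u)) m).
Proof.
rewrite sB s_sum; apply: (congr1 (fun x => _ - x)); apply: eq_bigr => i _.
rewrite sign_uea sZ sM; congr (_ *: _).
by rewrite addSnnS addnS exprS addnS exprS mulrA mulrNN mulr1 mul1r.
Qed.

Lemma QW_trivialP : acts_trivially s (@QW F p) <->
  (forall b u m, s (xW b u) m = 0).
Proof.
split=> [h b u m|h q m]; first by apply: h; apply: ideal_gen_sub; exists b, u.
move=> /(_ (fun q => forall m, s q m = 0)); apply.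
  split=> [|x y hx hy m'|x y hy m'|x y hy m'].
  - exact: s0l.
  - by rewrite sD hx hy addr0.
  - by rewrite sM hy s0r.
  - by rewrite sM hy.
by move=> y [b [u ->]].
Qed.

Lemma alg_rep_action : acts_trivially s (@QW F p) ->
  nlie_action (@W_br F p.+1) (fun f => s (ad_uea f)).
Proof.
move=> /QW_trivialP Q0.
split=> [m a i c x y|m a i j ij e|a|a b m|b u m].
- by apply: etrans (s_gen_linl _ _ _ _); rewrite /ad_uea adW_multilinear.
- rewrite /ad_uea (adW_alternating ij e).
  by apply: (linear_map0 (T := fun X => s (gen X) m)) => c X Y; exact: s_gen_linl.
- exact: s_linr.
- have e := s_gen_br (adW a) (adW b) m.
  apply/eqP; rewrite addrC -subr_eq; apply/eqP; apply: etrans (esym e) _.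
  apply: etrans (congr1 (fun X => s (gen X) m) (esym (vf_act_adW charF0 _ _))) _.
  apply: etrans (_ : \sum_i s (gen (adW (upd b i (vf_act (adW a) (b i))))) m = _).
    by apply: (linear_map_sum (T := fun X => s (gen X) m)) => c X Y; exact: s_gen_linl.
  apply: eq_bigr => i _; apply: (congr1 (fun x => s (gen (adW (upd b i x))) m)).
  by apply/esym; exact: W_br_act.
by apply/eqP; rewrite -subr_eq0; apply/eqP; apply: etrans (esym (alg_rep_xW _ _ _)) _.
Qed.

Lemma alg_rep_ad_stable (N : M -> Prop) : subspace N ->
  (forall f m, N m -> N (s (ad_uea f) m)) -> forall u m, N m -> N (s u m).
Proof.
move=> Nsub Nad; apply: (alg_rep_gen_stable sP Nsub).
apply: (vf_adW_ind charF0) => [c X Y hX hY m Nm|f]; last exact: Nad.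
by rewrite s_gen_linl; case: Nsub => _; apply; [exact: hX|exact: hY].
Qed.

Lemma alg_rep_ad_intertwine (M' : lmodType F) (s' : U -> M' -> M')
    (phi : {linear M -> M'}) : alg_rep s' ->
  (forall f m, s' (ad_uea f) (phi m) = phi (s (ad_uea f) m)) ->
  forall u m, s' u (phi m) = phi (s u m).
Proof.
move=> s'P had; apply: (alg_rep_gen_intertwine sP s'P).
apply: (vf_adW_ind charF0) => [c X Y hX hY m|f m]; last exact: had.
rewrite s_gen_linl linearP -hX -hY.
case: s'P => _ s'lin _ _; apply: etrans (s'lin _ _ _ _).
by apply: (congr1 (s'^~ _)); exact: uea_gen_lin.
Qed.
End OneModule.

Lemma irreducible_corresponding (M : lmodType F)
    (B : ('I_p.+2 -> W * M) -> (W * M)%type) (s : U -> M -> M) :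
  alg_rep s -> corresponding B s ->
  irreducible_under (nlie_act B) <-> irreducible_under s.
Proof.
move=> sP BS; split=> -[M0 irr]; split=> // N Nsub Nst; apply: irr => //.
  by move=> f m Nm; rewrite BS; exact: Nst.
apply: (alg_rep_ad_stable sP Nsub) => f m Nm.
by rewrite -BS; exact: Nst.
Qed.
End Dictionary.

Section Bijection.
Context (F : fieldType) (charF0 : [pchar F] =i pred0) (p : nat).
Local Notation W := (fps F p.+1).
Local Notation U := (uea (@vf_br F p.+1)).

Lemma corresponding_alg_rep (M : lmodType F)
    (B : ('I_p.+2 -> W * M) -> (W * M)%type) : nlie_rep (@W_br F p.+1) B ->
  exists s : U -> M -> M,
    [/\ alg_rep s, acts_trivially s (@QW F p) & corresponding B s].
Proof.
move=> repB; have rhoP := nlie_rep_action repB.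
pose s := @uea_lift F _ (@vf_br F p.+1) M (lie_action (nlie_act B)).
have lin_r := lie_action_linr rhoP; have lin_l := lie_action_linl rhoP.
have tau_br := lie_action_br charF0 rhoP.
have sP : alg_rep s by exact: uea_lift_rep.
have BS : corresponding B s.
  move=> f m; apply: etrans (esym (lie_action_adW charF0 rhoP f m)) _.
  by apply/esym; exact: uea_lift_gen.
exists s; split=> //; apply/(QW_trivialP sP) => b u m.
rewrite (alg_rep_xW sP); apply/eqP; rewrite subr_eq0; apply/eqP.
apply: etrans (esym (BS _ _)) _; apply: etrans (action_bracket rhoP _ _ _) _.
apply: eq_bigr => i _; congr (_ *: _); apply: etrans (BS _ _) _.
by apply: congr1; exact: BS.
Qed.

(** The elements ad_uea f generate the enveloping algebra. *)
Lemma corresponding_alg_rep_uniq (M : lmodType F)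
    (B : ('I_p.+2 -> W * M) -> (W * M)%type) (s s' : U -> M -> M) :
  alg_rep s -> corresponding B s -> alg_rep s' -> corresponding B s' -> s = s'.
Proof.
move=> sP BS s'P BS'; apply/funext => u; apply/funext => m; apply/esym.
apply: (alg_rep_ad_intertwine charF0 sP (phi := idfun) s'P) => f x.
by rewrite /= -BS -BS'.
Qed.

Lemma corresponding_nlie_rep (M : lmodType F) (s : U -> M -> M) :
  alg_rep s -> acts_trivially s (@QW F p) ->
  exists B : ('I_p.+2 -> W * M) -> (W * M)%type,
    nlie_rep (@W_br F p.+1) B /\ corresponding B s.
Proof.
move=> sP sQ; have rhoP := alg_rep_action charF0 sP sQ.
exists (action_ext (@W_br F p.+1) (fun f => s (ad_uea f))); split.
  exact: action_ext_rep (W_br_nlie charF0 p) rhoP.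
by move=> f m; rewrite (nlie_act_ext rhoP).
Qed.

Lemma corresponding_nlie_rep_uniq (M : lmodType F)
    (B B' : ('I_p.+2 -> W * M) -> (W * M)%type) (s : U -> M -> M) :
  nlie_rep (@W_br F p.+1) B -> corresponding B s ->
  nlie_rep (@W_br F p.+1) B' -> corresponding B' s -> B = B'.
Proof.
move=> repB BS repB' BS'; apply/funext => z.
rewrite (nlie_repE repB) (nlie_repE repB'); congr action_ext.
by apply/funext => f; apply/funext => m; rewrite BS BS'.
Qed.

Lemma corresponding_iso (M M' : lmodType F)
    (B : ('I_p.+2 -> W * M) -> (W * M)%type)
    (B' : ('I_p.+2 -> W * M') -> (W * M')%type)
    (s : U -> M -> M) (s' : U -> M' -> M') :
  nlie_rep (@W_br F p.+1) B -> alg_rep s -> corresponding B s ->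
  nlie_rep (@W_br F p.+1) B' -> alg_rep s' -> corresponding B' s' ->
  (nlie_rep_iso B B' <-> alg_rep_iso s s').
Proof.
move=> repB sP BS repB' s'P BS'.
split=> -[phi [bij_phi h]]; exists phi; split=> //.
  apply: (alg_rep_ad_intertwine charF0 sP s'P) => f m.
  rewrite -BS -BS' /nlie_act.
  have := h (frcons (fun i => (f i, 0)) (0, m)) => /(congr1 snd) /= <-.
  congr (B' _).2; apply/funext => i.
  by rewrite /frcons; case: unlift => [j|] //=; rewrite linear0.
move=> z; rewrite (nlie_repE repB) (nlie_repE repB'); congr (_, _) => /=.
rewrite linear_sum; apply: eq_bigr => i _ /=.
by rewrite linearZ /= BS BS' h.
Qed.
End Bijection.

(* n = p + 2 *)
Theorem theorem4 (F : fieldType) (charF0 : [pchar F] =i pred0)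
    (p : nat) (n_ge3 : (3 <= p.+2)%N) :
  [/\ forall (M : lmodType F) (B : ('I_p.+2 -> fps F p.+1 * M) -> fps F p.+1 * M),
        irr_nlie_rep (@W_br F p.+1) B ->
        exists! s : uea (@vf_br F p.+1) -> M -> M,
          [/\ irr_alg_rep s, acts_trivially s (@QW F p) & corresponding B s],
      forall (M : lmodType F) (s : uea (@vf_br F p.+1) -> M -> M),
        irr_alg_rep s -> acts_trivially s (@QW F p) ->
        exists! B : ('I_p.+2 -> fps F p.+1 * M) -> fps F p.+1 * M,
          irr_nlie_rep (@W_br F p.+1) B /\ corresponding B s
    & forall (M M' : lmodType F)
        (B : ('I_p.+2 -> fps F p.+1 * M) -> fps F p.+1 * M)
        (B' : ('I_p.+2 -> fps F p.+1 * M') -> fps F p.+1 * M')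
        (s : uea (@vf_br F p.+1) -> M -> M)
        (s' : uea (@vf_br F p.+1) -> M' -> M'),
        irr_nlie_rep (@W_br F p.+1) B -> irr_alg_rep s ->
        acts_trivially s (@QW F p) -> corresponding B s ->
        irr_nlie_rep (@W_br F p.+1) B' -> irr_alg_rep s' ->
        acts_trivially s' (@QW F p) -> corresponding B' s' ->
        (nlie_rep_iso B B' <-> alg_rep_iso s s')].
Proof.
split=> [M B [repB irrB]|M s [sP irr_s] sQ|M M' B B' s s'].
- have [s [sP sQ BS]] := corresponding_alg_rep charF0 repB.
  exists s; split=> [|s' [[s'P _] _ BS']].
    by split=> //; split=> //; apply/(irreducible_corresponding charF0 sP BS).
  exact: (corresponding_alg_rep_uniq charF0 sP BS s'P BS').
- have [B [repB BS]] := corresponding_nlie_rep charF0 sP sQ.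
  exists B; split=> [|B' [[repB' _] BS']].
    by split=> //; split=> //; apply/(irreducible_corresponding charF0 sP BS).
  exact: (corresponding_nlie_rep_uniq repB BS repB' BS').
move=> [repB _] [sP _] _ BS [repB' _] [s'P _] _ BS'.
exact: (corresponding_iso charF0 repB sP BS repB' s'P BS').
Qed.
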